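(* Let a system $$\Big(\frac{d}{dx}+\lambda q_1+q_0(x)\Big)u(x,\lambda)=0\quad(0<x<l),\qquad q_1=-\breve J,\qquad q_0=v_a\sigma_3+\breve J(v_eI_2+v_s\sigma_3),$$ be given, where $v_e,v_a,v_s$ are real-valued, locally integrable on $[0,l)$, and $q_0$ is bounded in a neighbourhood of zero. Let $m>0$ and $\varkappa>0$ be integers and let $$A=\begin{bmatrix}\mathcal A_1&0\\R&\mathcal A_2\end{bmatrix},\qquad S(0)=\begin{bmatrix}\mathcal S_1(0)&0\\0&0\end{bmatrix},\qquad \Pi(0)=\begin{bmatrix}\Psi_1(0)\\\Psi_2(0)\end{bmatrix},$$ where $\mathcal A_1$ and $\mathcal S_1(0)$ are $m\times m$ matrices, $A$ and $S(0)$ are $(m+\varkappa)\times(m+\varkappa)$ matrices, $\Psi_1(0)$ is $m\times2$, $\Psi_2(0)$ is $\varkappa\times2$, $\mathcal A_2$ is a lower triangular $\varkappa\times\varkappa$ matrix, and $R=\Psi_2(0)\breve J\Psi_1(0)^*\mathcal S_1(0)^{-1}$. Assume $$\mathcal A_1\mathcal S_1(0)-\mathcal S_1(0)\mathcal A_1^*=\Psi_1(0)\breve J\Psi_1(0)^*,\qquad\Psi_2(0)\breve J\Psi_2(0)^*=0,\qquad \mathcal S_1(0)>0.$$ Define $\Pi(x)$ and $S(x)$ on $[0,l)$ by these values at $x=0$ and the equations $$\Pi_x=A\Pi q_1+\Pi q_0,\qquad S_x=\Pi\Pi^*,$$ and assume $S(x)>0$ for $x>0$. Let $h(0)$ be the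 first row of $\Psi_2(0)$ and suppose $h(0)=c[1\;\;0]$ or $h(0)=c[0\;\;1]$ with $c\ne0$. Then the transformed system $$\Big(\frac{d}{dx}+\lambda q_1+\widetilde q_0(x)\Big)\widetilde u(x,\lambda)=0,\qquad \widetilde q_0=q_0+\breve JX\breve J^*-X,\quad X=\Pi^*S^{-1}\Pi,$$ has the fundamental solution $\widetilde u=w_Au$, where $u$ is a fundamental solution of the initial system and $$w_A(x,\lambda)=I_2-\breve J\Pi(x)^*S(x)^{-1}(A-\lambda I_{m+\varkappa})^{-1}\Pi(x),\qquad \lambda\notin\sigma(A)\cup\sigma(A^* ).$$ Moreover, $$\widetilde q_0(x)=\frac{\kappa}{x}\sigma_3+\Upsilon(x),$$ where $\Upsilon$ is bounded in a neighbourhood of zero, and: $\kappa=\varkappa$ if $\varkappa$ is odd and $h(0)=c[0\;\;1]$, or if $\varkappa$ is even and $h(0)=c[1\;\;0]$; $\kappa=-\varkappa$ if $\varkappa$ is even and $h(0)=c[0\;\;1]$, or if $\varkappa$ is odd and $h(0)=c[1\;\;0]$.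
   Context: Notation: $\sigma_3=\begin{bmatrix}1&0\\0&-1\end{bmatrix}$, $\breve J=\begin{bmatrix}0&1\\-1&0\end{bmatrix}$; $M^*$ is the conjugate transpose, $M>0$ means Hermitian positive definite, $\sigma(A)$ is the spectrum; $l>0$. A neighbourhood of zero means an interval $(0,\varepsilon)$ with $\varepsilon>0$. A fundamental solution is a non-degenerate (invertible for each $x>0$) $2\times 2$ matrix solution; no normalization at $x=0$ is required. Differential equations with locally integrable coefficients are understood in the sense of absolutely continuous solutions (equalities a.e.). *)

(* Defs.v *)
From mathcomp Require Export all_boot all_order all_algebra.
From mathcomp Require Export all_classical all_reals all_analysis.
From mathcomp Require Export complex.

Set Implicit Arguments.
Unset Strict Implicit.
Unset Printing Implicit Defensive.

Import Order.TTheory GRing.Theory Num.Theory numFieldNormedType.Exports.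

Local Open Scope classical_set_scope.
Local Open Scope ring_scope.
Local Open Scope complex_scope.
Local Open Scope sesquilinear_scope.

Section Matrices.
Variable R : realType.
Local Notation C := R[i].

Definition mx2 (a b c d : C) : 'M[C]_2 :=
  \matrix_(i, j) if i == 0 then (if j == 0 then a else b)
                 else (if j == 0 then c else d).

Definition row2 (a b : C) : 'rV[C]_2 := \row_j if j == 0 then a else b.

Definition sigma3 : 'M[C]_2 := mx2 1 0 0 (-1).
Definition breveJ : 'M[C]_2 := mx2 0 1 (-1) 0.

Definition posdef n (M : 'M[C]_n) : Prop :=
  M \is hermsymmx /\
  forall v : 'rV[C]_n, v != 0 -> 0 < (v *m M *m v ^t*) 0 0.

Definition not_in_spectra n (A : 'M[C]_n) (lam : C) : Prop :=
  ~~ eigenvalue A lam /\ ~~ eigenvalue (A ^t*) lam.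

Definition bounded_near_zero p q (F : R -> 'M[C]_(p, q)) : Prop :=
  exists2 eps : R, 0 < eps &
  exists M : R, forall x, 0 < x < eps -> forall i j, `|F x i j| <= M%:C.

End Matrices.

Section AbsolutelyContinuousSolutions.
Variable R : realType.
Local Notation C := R[i].

(* The ]s i, t i[ are n pairwise disjoint (possibly empty) open subintervals. *)
Definition abs_continuous (a b : R) (f : R -> R) : Prop :=
  forall eps : R, 0 < eps -> exists2 delta : R, 0 < delta &
  forall (n : nat) (s t : 'I_n -> R),
    (forall i, a <= s i /\ s i <= t i /\ t i <= b) ->
    (forall i j, i != j -> t i <= s j \/ t j <= s i) ->
    \sum_i (t i - s i) < delta ->
    \sum_i `|f (t i) - f (s i)| < eps.

Definition mx_loc_abs_continuous p q (I : set R) (F : R -> 'M[C]_(p, q)) :=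
  forall a b : R, a <= b -> `[a, b]%classic `<=` I -> forall i j,
    abs_continuous a b (fun x => complex.Re (F x i j)) /\
    abs_continuous a b (fun x => complex.Im (F x i j)).

Definition mx_is_derive p q (F : R -> 'M[C]_(p, q)) (x : R)
    (D : 'M[C]_(p, q)) : Prop :=
  forall i j,
    is_derive x 1 (fun y => complex.Re (F y i j)) (complex.Re (D i j)) /\
    is_derive x 1 (fun y => complex.Im (F y i j)) (complex.Im (D i j)).

Definition ac_derivative p q (I : set R) (F G : R -> 'M[C]_(p, q)) : Prop :=
  mx_loc_abs_continuous I F /\
  {ae (@lebesgue_measure R), forall x, I x -> mx_is_derive F x (G x)}.

Definition loc_integrable (l : R) (v : R -> R) : Prop :=
  forall b : R, 0 <= b < l ->
    (@lebesgue_measure R).-integrable `[0, b] (EFin \o v).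

End AbsolutelyContinuousSolutions.

Section DiracSystem.
Variable R : realType.
Local Notation C := R[i].
Local Notation J := (breveJ R).

Definition q1 : 'M[C]_2 := - J.

Definition q0 (va ve vs : R -> R) (x : R) : 'M[C]_2 :=
  (va x)%:C *: sigma3 R
  + J *m ((ve x)%:C *: 1%:M + (vs x)%:C *: sigma3 R).

Definition is_solution (l : R) (q : R -> 'M[C]_2) (lam : C)
    (u : R -> 'M[C]_2) : Prop :=
  mx_loc_abs_continuous `]0, l[%classic u /\
  {ae (@lebesgue_measure R), forall x, 0 < x < l ->
     exists2 ux, mx_is_derive u x ux &
       ux + (lam *: q1 + q x) *m u x = 0}.

Definition is_fundamental_solution (l : R) (q : R -> 'M[C]_2) (lam : C)
    (u : R -> 'M[C]_2) : Prop :=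
  is_solution l q lam u /\ forall x, 0 < x < l -> u x \in unitmx.

Definition Xmx n (Pi : R -> 'M[C]_(n, 2)) (S : R -> 'M[C]_n) (x : R)
    : 'M[C]_2 :=
  (Pi x) ^t* *m invmx (S x) *m Pi x.

Definition q0_transformed n (q : R -> 'M[C]_2) (Pi : R -> 'M[C]_(n, 2))
    (S : R -> 'M[C]_n) (x : R) : 'M[C]_2 :=
  q x + J *m Xmx Pi S x *m J ^t* - Xmx Pi S x.

Definition wA n (A : 'M[C]_n) (Pi : R -> 'M[C]_(n, 2)) (S : R -> 'M[C]_n)
    (x : R) (lam : C) : 'M[C]_2 :=
  1%:M - J *m (Pi x) ^t* *m invmx (S x) *m invmx (A - lam%:M) *m Pi x.

End DiracSystem.

Arguments q1 {R}.
Arguments sigma3 {R}.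
Arguments breveJ {R}.

(* Main.v *)
(* The identity A S - S A^* = Pi J Pi^* persists along the flow, and with it
   w_A satisfies w' = lam (J w - w J) - qt w + w q0, where qt is the transformed
   coefficient; hence w_A u solves the transformed system.  The inverse of w_A
   is explicit (Woodbury).

   For the behaviour at zero, the rows of Psi2 are adjoined one at a time.
   Since A2 is lower triangular, the leading blocks of A, Pi, S again satisfy
   the hypotheses.  Adjoining a row to blocks Pr, Sr with transformed
   coefficient qr replaces X by X + h^* h / tau, where
     h = p - s Sr^-1 Pr,  tau = g - s Sr^-1 s^*,
     h' = - a h J + h qr,  tau' = h h^*,  0 < tau <= g -> 0.
   Inductively qr = (kappa/x) sigma3 + O(1) with |kappa| = r, so one component
   of h behaves like x^r and the other like x^-r; integrability of |h|^2 rules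
   the second out.  Hence |h|^2 is comparable to x^(2r) and concentrated in one
   component, tau = x |h|^2 / (2r+1) (1 + O(x)), and h^* h / tau contributes
   (2r+1)/x to a single diagonal entry of X: kappa passes to -+(r+1), with
   alternating sign, the first sign being decided by h(0). *)

Require Import Defs.
From mathcomp Require Import perm ring lra.

Set Implicit Arguments.
Unset Strict Implicit.
Unset Printing Implicit Defensive.

Import Order.TTheory GRing.Theory Num.Theory numFieldNormedType.Exports.

Local Open Scope classical_set_scope.
Local Open Scope ring_scope.
Local Open Scope complex_scope.
Local Open Scope sesquilinear_scope.

(** * Absolutely continuous functions with nonnegative derivative *)

Section AbsoluteContinuityMonotone.
Variable R : realType.
Implicit Types (f g : R -> R) (a b x y : R).
Local Notation mu := (@lebesgue_measure R).

(** Two obstacles shape the proof. The coefficients are merely integrable, so every differential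
    equation holds only almost everywhere. And [S] is singular at zero, so in general [h] and [tau]
    are controlled only on compact subintervals of the open interval. One tool answers both: an
    absolutely continuous function whose derivative is nonnegative almost everywhere is
    nondecreasing. Estimates are then obtained without integrating: either the unknown is compared
    with an explicit multiple of a power of [x], or the unknown times a well-chosen factor is shown
    to be monotone, and a zero limit at the origin takes the place of an initial value. The case
    [r = 0] is separate, because without a singular term the equation favours neither component of
    [h]. There the leading block of [S] is still invertible at zero, [h] extends continuously to
    zero, and its value [h(0)] decides which component dominates. For [r > 0] dominance follows from
    the positivity and zero limit of [tau]. *)

Lemma near_derive_ge0 f x d eta : is_derive x 1 f d -> 0 <= d -> 0 < eta ->
  exists2 r, 0 < r & forall y, `|y - x| < r ->
    (x <= y -> f x <= f y + eta * (y - x)) /\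
    (y <= x -> f y <= f x + eta * (x - y)).
Proof.
move=> [fx dE] d0 eta0.
have := fx; rewrite /derivable => /cvg_ex[d' fd'].
have d'E : d' = d by rewrite -dE; apply/esym/cvg_lim.
have : \forall h \near 0^', - eta < h^-1 *: (f (h *: 1 + x) - f x) :> R.
  apply: (fd' (fun z => - eta < z)); rewrite d'E.
  by apply: lt_nbhsr; rewrite (lt_le_trans _ d0)// oppr_lt0.
move=> [r /= r0 hr]; exists r => // y yr.
have [->|yx] := eqVneq y x; first by rewrite subrr mulr0 addr0; split => _; exact: lexx.
have yx0 : y - x != 0 by rewrite subr_eq0.
have := hr (y - x); rewrite /= sub0r normrN => /(_ yr yx0).
rewrite /GRing.scale /= mulr1 subrK => H; split => xy.
  have xy' : 0 < y - x by rewrite subr_gt0 lt_neqAle eq_sym yx.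
  by move: H; rewrite mulrC ltr_pdivlMr//; lra.
have xy' : y - x < 0 by rewrite subr_lt0 lt_neqAle yx.
by move: H; rewrite mulrC ltr_ndivlMr//; lra.
Qed.

(** Lists replace indexed families so that the supremum argument can cons an interval. Each new
    interval lies to the right of the old ones, so the list runs from right to left. *)
Lemma ac_sum f a b eps : abs_continuous a b f -> 0 < eps ->
  exists2 delta : R, 0 < delta & forall s : seq (R * R),
    all (fun p => [&& a <= p.1, p.1 <= p.2 & p.2 <= b]) s ->
    pairwise (fun p q => q.2 <= p.1) s ->
    \sum_(p <- s) (p.2 - p.1) < delta ->
    \sum_(p <- s) `|f p.2 - f p.1| < eps.
Proof.
move=> fac eps0; have [delta d0 H] := fac _ eps0.
exists delta => // s /allP sab sdis; rewrite 2!(big_nth (0, 0)) 2!big_mkord.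
apply: H => [i|i j ij].
  by have /and3P[] := sab (nth (0, 0) s i) (mem_nth _ (ltn_ord i)).
have /(pairwiseP (0, 0)) sd := sdis.
move: ij; rewrite neq_ltn => /orP[ij|ij]; [right|left];
  by apply: sd => //; rewrite inE.
Qed.

(* A supremum argument: [f] loses at most [eta] per unit length at the good points,
   and the exceptional null set is crossed inside an open set of small measure,
   where absolute continuity bounds the total variation picked up. *)
Lemma ae_derive_ge0_le f a b : a <= b -> abs_continuous a b f ->
  {ae mu, forall x, a < x < b -> exists2 d : R, is_derive x 1 f d & 0 <= d} ->
  f a <= f b.
Proof.
move=> ab fac fae; apply/ler_addgt0Pr => e e0.
(* The summand [1] keeps the denominator positive when [a = b], and [eta * (b - a) <= e / 2] still
   holds. The other half of [e] pays for the crossings inside [U]. *)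
pose eta := e / 2 / (b - a + 1).
have eta0 : 0 < eta by rewrite !divr_gt0//; lra.
have [delta delta0 fdelta] := ac_sum fac (divr_gt0 e0 (ltr0Sn R 1)).
(* The end points join the exceptional set, since the derivative is known only in the open
   interval. *)
have [N [mN muN badN]] : mu.-negligible
    ([set x | ~ (a < x < b -> exists2 d : R, is_derive x 1 f d & 0 <= d)] `|`
     ([set a] `|` [set b])).
  apply: negligibleU; first exact: fae.
  by apply: negligibleU; apply/negligibleP => //; exact: lebesgue_measure_set1.
have muNoo : (mu N < +oo)%E by rewrite muN.
have [U [oU NU muU]] := lebesgue_regularity_outer mN muNoo delta0.
have mU : measurable U by exact: measurable_realfun.open_measurable.
have {}muU : (mu U < delta%:E)%E.
  apply: le_lt_trans muU.
  rewrite -[X in mu X](setDUK NU) measureU//; [|exact: measurableD|by rewrite setDIK].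
  by rewrite [X in (X + _)%E]muN add0e.
(* The list records the intervals crossed so far inside [U]. Bounding their total length by the
   measure of [U] up to [x] is stable under extension, and at [b] it makes absolute continuity
   applicable. *)
pose Phi x := a <= x <= b /\ exists s : seq (R * R), [/\
  all (fun p => [&& a <= p.1, p.1 <= p.2 & p.2 <= x]) s,
  pairwise (fun p q => q.2 <= p.1) s,
  ((\sum_(p <- s) (p.2 - p.1))%:E <= mu (U `&` `[a, x]))%E &
  f a <= f x + eta * (x - a) + \sum_(p <- s) `|f p.2 - f p.1|].
have Phia : Phi a.
  split; first by rewrite lexx.
  by exists [::]; rewrite !big_nil; split => //; rewrite subrr mulr0 !addr0.
have extend x y : Phi x -> x <= y <= b ->
    f x <= f y + eta * (y - x) \/ `[x, y]%classic `<=` U -> Phi y.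
  move=> [/andP[ax xb] [s [sx sd smu fs]]] /andP[xy yb] H.
  split; first by rewrite yb (le_trans ax xy).
  have sy : all (fun p => [&& a <= p.1, p.1 <= p.2 & p.2 <= y]) s.
    by apply: sub_all sx => p /and3P[-> ->] /le_trans; exact.
  case: H => [fxy|xyU].
    exists s; split => //; last lra.
    apply: le_trans smu _; apply: le_measure; rewrite ?inE//.
    - exact: measurableI.
    - exact: measurableI.
    - apply: setIS; apply: subset_itvl; by rewrite bnd_simp.
  exists ((x, y) :: s); split => /=.
  - by rewrite sy ax xy lexx.
  - rewrite sd andbT; apply: sub_all sx => p /=.
    by move=> /and3P[].
  - rewrite big_cons/= EFinD.
    (* The half-open interval is disjoint from [[a, x]], so the measures add although neighbouring
       intervals share an end point. *)
    have UxU : (mu `]x, y] + mu (U `&` `[a, x]) <= mu (U `&` `[a, y]))%E.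
      rewrite -measureU//; first last.
      + rewrite -subset0 => z [/=]; rewrite !in_itv/= => /andP[xz _] [_ /andP[_ zx]].
        by move: (lt_le_trans xz zx); rewrite ltxx.
      + exact: measurableI.
      apply: le_measure; rewrite ?inE//.
      + by apply: measurableU => //; exact: measurableI.
      + exact: measurableI.
      + move=> z [|[]]/=; rewrite !in_itv/=.
          move=> /andP[xz zy]; split; first by apply: xyU; rewrite /= in_itv/= (ltW xz).
          by rewrite zy (le_trans ax (ltW xz)).
        by move=> Uz /andP[-> zx]; split => //; exact: le_trans zx xy.
    apply: le_trans UxU; apply: leeD => //.
    rewrite lebesgue_measure_itv/= lte_fin; case: ltP => // yx.
    by rewrite lee_fin subr_le0.
  - rewrite big_cons/=.
    have := ler_norm (f x - f y); rewrite distrC.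
    have : 0 <= eta * (y - x) by rewrite mulr_ge0 ?subr_ge0// ltW.
    by lra.
(* Only pairs with [c] as an end point are compared: the supremum is reached from its left, then
   passed on its right. *)
have local c : a <= c <= b -> exists2 r, 0 < r & forall x y,
    a <= x -> x <= c -> c <= y -> y <= b -> y - x < r -> x = c \/ y = c ->
    f x <= f y + eta * (y - x) \/ `[x, y]%classic `<=` U.
  move=> /andP[ac cb]; have [Nc|Nc] := pselect (N c).
    have [r /= r0 rU] : nbhs c U by apply: open_nbhs_nbhs; split => //; exact: NU.
    exists r => // x y ax xc cy yb xyr _; right => z /=; rewrite in_itv/= => /andP[xz zy].
    apply: rU => /=; rewrite ltr_norml; apply/andP; split; lra.
  have /not_orP[/contrapT gc /not_orP[/eqP ca /eqP cb']] := contra_not (@badN c) Nc.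
  have [|d fd d0] := gc; first by rewrite !lt_neqAle ac cb cb' eq_sym ca.
  have [r r0 fr] := near_derive_ge0 fd d0 eta0.
  exists r => // x y ax xc cy yb xyr [->|->]; left.
    by have [|+ _] := fr y; [rewrite ger0_norm; lra|exact].
  by have [|_] := fr x; [rewrite ler0_norm; lra|exact].
have supPhi : has_sup Phi by split; [exists a|exists b => x [/andP[]]].
set c := sup Phi.
have ac : a <= c by apply: ub_le_sup => //; case: supPhi.
have cb : c <= b by apply: ge_sup => [|x [/andP[]]//]; exists a.
have [|r r0 rc] := local c; first by rewrite ac.
have Phic : Phi c.
  have [x Px cx] := sup_adherent r0 supPhi.
  have xc : x <= c by apply: ub_le_sup => //; case: supPhi.
  apply: (extend x) => //; first by rewrite xc.
  apply: rc => //; [by case: Px => /andP[]|rewrite -/c in cx; lra|by right].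
have Phib : Phi b.
  have [->//|cb'] := eqVneq b c.
  have {cb'} cb' : c < b by rewrite lt_neqAle eq_sym cb' cb.
  pose y := Num.min b (c + r / 2).
  have cy : c < y by rewrite lt_min cb'/=; lra.
  have yb : y <= b by rewrite ge_min lexx.
  have yc : y <= c + r / 2 by rewrite ge_min lexx orbT.
  suff : Phi y.
    by move=> Py; have := ub_le_sup (proj2 supPhi) Py; rewrite -/c leNgt cy.
  apply: (extend c) => //; first by rewrite yb ltW.
  by apply: rc => //; [exact: ltW|lra|left].
case: Phib => _ [s [sab sd smu fs]].
have slt : \sum_(p <- s) (p.2 - p.1) < delta.
  rewrite -lte_fin; apply: le_lt_trans muU; apply: le_trans smu _.
  apply: le_measure; rewrite ?inE//; exact: measurableI.
have := fdelta _ sab sd slt.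
have : eta * (b - a) <= e / 2.
  rewrite /eta mulrAC -mulrA ler_piMr//; first by rewrite divr_ge0// ltW.
  by rewrite ler_pdivrMr; lra.
lra.
Qed.

End AbsoluteContinuityMonotone.

(** * Closure properties of absolutely continuous functions *)

Section AbsoluteContinuityClosure.
Variable R : realType.
Implicit Types (f g h : R -> R) (a b x y : R).

(** A single criterion for sums, products and inverses: in each case an increment of the result is
    bounded by increments of the arguments. *)
Lemma ac_dominated f g h a b K :
  abs_continuous a b f -> abs_continuous a b g -> 0 <= K ->
  (forall s t, a <= s <= b -> a <= t <= b ->
    `|h t - h s| <= K * (`|f t - f s| + `|g t - g s|)) ->
  abs_continuous a b h.
Proof.
move=> fac gac K0 hfg e e0.
(* [K + 1] serves as divisor because [K = 0] is allowed. *)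
have K1 : 0 < K + 1 by rewrite ltr_wpDl.
have e'0 : 0 < e / 2 / (K + 1) by rewrite !divr_gt0.
have [d1 d10 H1] := fac _ e'0; have [d2 d20 H2] := gac _ e'0.
exists (Num.min d1 d2); first by rewrite lt_min d10.
move=> n s t sab sdis; rewrite lt_min => /andP[/(H1 _ _ _ sab sdis) fs /(H2 _ _ _ sab sdis) gs].
have inab i : (a <= s i <= b) /\ (a <= t i <= b).
  have [as_ [st tb]] := sab i.
  by rewrite as_ tb (le_trans st tb) (le_trans as_ st).
apply: (@le_lt_trans _ _ ((K + 1) * (\sum_i `|f (t i) - f (s i)| + \sum_i `|g (t i) - g (s i)|))).
  rewrite -big_split mulr_sumr; apply: ler_sum => i _.
  apply: (le_trans (hfg _ _ (proj1 (inab i)) (proj2 (inab i)))).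
  by apply: ler_wpM2r; rewrite ?addr_ge0// lerDl.
rewrite mulrC -ltr_pdivlMr//; have := ltrD fs gs.
by rewrite -mulrDl -splitr.
Qed.

Lemma ac_id a b : abs_continuous a b (@id R).
Proof.
move=> e e0; exists e => // n s t st _; apply: le_lt_trans.
apply: ler_sum => i _; rewrite ger0_norm// subr_ge0.
by have [_ []] := st i.
Qed.

Lemma ac_cst a b k : abs_continuous a b (fun=> k : R).
Proof.
apply: (ac_dominated (@ac_id a b) (@ac_id a b) (lexx 0)) => s t _ _.
by rewrite subrr normr0 mul0r.
Qed.

Lemma acD f g a b : abs_continuous a b f -> abs_continuous a b g ->
  abs_continuous a b (fun x => f x + g x).
Proof.
move=> fac gac; apply: (ac_dominated fac gac ler01) => s t _ _.
by rewrite mul1r opprD addrACA ler_normD.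
Qed.

Lemma acN f a b : abs_continuous a b f -> abs_continuous a b (fun x => - f x).
Proof.
move=> fac; apply: (ac_dominated fac fac ler01) => s t _ _.
by rewrite mul1r -opprD normrN lerDl.
Qed.

Lemma acB f g a b : abs_continuous a b f -> abs_continuous a b g ->
  abs_continuous a b (fun x => f x - g x).
Proof. by move=> fac /acN gac; exact: acD. Qed.

Lemma ac_uniform f a b eps : abs_continuous a b f -> 0 < eps ->
  exists2 delta : R, 0 < delta & forall s t, a <= s <= b -> a <= t <= b ->
    `|t - s| < delta -> `|f t - f s| < eps.
Proof.
move=> fac e0; have [d d0 H] := fac _ e0; exists d => //.
suff key s t : a <= s -> s <= t -> t <= b -> `|t - s| < d -> `|f t - f s| < eps.
  move=> s t /andP[as_ sb] /andP[at_ tb]; have [st|/ltW ts] := leP s t.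
    exact: key.
  by rewrite distrC [X in _ -> X < _]distrC; exact: key.
move=> as_ st tb std; have := H 1%N (fun=> s) (fun=> t); rewrite !big_ord1.
apply => //; last by rewrite ger0_norm in std => //; rewrite subr_ge0.
by move=> i j; rewrite !ord1.
Qed.

(** Let [d] be the modulus for oscillation [1]. A walk from [a] in steps of length [d / 2] changes
    the function by less than [1] per step, and the length of the interval bounds the number of
    steps. *)
Lemma ac_bounded f a b : abs_continuous a b f ->
  exists M, forall x, a <= x <= b -> `|f x| <= M.
Proof.
move=> fac; have [d d0 H] := ac_uniform fac ltr01.
have key n x : a <= x <= b -> x - a <= n%:R * (d / 2) -> `|f x| <= `|f a| + n%:R.
  elim: n x => [|n IH] x /andP[ax xb].
    by rewrite mul0r => xa; have -> : x = a; [lra|rewrite addr0].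
  have [xd _|dx] := leP x (a + d / 2).
    have /= := H a x; rewrite lexx (le_trans ax xb) ax xb => /(_ isT isT).
    rewrite ger0_norm; last lra.
    have -> : x - a < d by lra.
    move=> /(_ isT); have := ler_normD (f x - f a) (f a); rewrite subrK.
    have : 0 <= n%:R :> R by [].
    by rewrite -natr1; lra.
  rewrite -natr1 mulrDl mul1r => xn.
  have xdab : a <= x - d / 2 <= b by apply/andP; split; lra.
  have := IH _ xdab; have -> : x - d / 2 - a <= n%:R * (d / 2) by lra.
  have := H _ x xdab; rewrite ax xb => /(_ isT); rewrite ger0_norm; last lra.
  have -> : x - (x - d / 2) < d by lra.
  move=> /(_ isT) + /(_ isT).
  have := ler_normD (f x - f (x - d / 2)) (f (x - d / 2)); rewrite subrK.
  lra.
exists (`|f a| + (Num.truncn ((b - a) / (d / 2))).+1%:R) => x /andP[ax xb].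
apply: key; first by rewrite ax.
have d20 : 0 < d / 2 by lra.
rewrite -ler_pdivrMr//; apply: le_trans (ltW (truncnS_gt _)).
by rewrite ler_pM2r ?invr_gt0//; lra.
Qed.

Lemma acM f g a b : abs_continuous a b f -> abs_continuous a b g ->
  abs_continuous a b (fun x => f x * g x).
Proof.
move=> fac gac; have [M fM] := ac_bounded fac; have [N gN] := ac_bounded gac.
(* Absolute values are taken because the interval may be empty, and then [M] and [N] may be
   negative. *)
apply: (ac_dominated fac gac (K := `|M| + `|N|)); first by rewrite addr_ge0.
move=> s t sab tab.
have -> : f t * g t - f s * g s = f t * (g t - g s) + g s * (f t - f s) by ring.
apply: (le_trans (ler_normD _ _)); rewrite !normrM.
rewrite addrC mulrDr; apply: lerD; apply: ler_wpM2r => //.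
  by rewrite (le_trans (gN _ sab))// (le_trans (ler_norm _))// lerDr.
by rewrite (le_trans (fM _ tab))// (le_trans (ler_norm _))// lerDl.
Qed.

(** Composition with the projection onto [[a, b]], which is 1-Lipschitz, gives a function continuous
    on the whole line, to which the extreme value theorem applies. *)
Lemma ac_lower_bound f a b : a <= b -> abs_continuous a b f ->
  (forall x, a <= x <= b -> 0 < f x) ->
  exists2 c, 0 < c & forall x, a <= x <= b -> c <= f x.
Proof.
move=> ab fac f0; pose clamp x := Num.max a (Num.min x b).
have clampab x : a <= clamp x <= b.
  by rewrite /clamp le_max lexx ge_max ab ge_min lexx orbT.
have clampE x : a <= x <= b -> clamp x = x.
  by move=> /andP[ax xb]; rewrite /clamp min_l// max_r.
have clamp1 x y : `|clamp y - clamp x| <= `|y - x|.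
  apply: (@le_trans _ _ `|Num.min y b - Num.min x b|).
    rewrite /clamp ler_norml; have := ler_norm (Num.min y b - Num.min x b).
    have := ler_norm (Num.min x b - Num.min y b); rewrite distrC.
    by case: (ltP a (Num.min x b)); case: (ltP a (Num.min y b)) => *; apply/andP; split; lra.
  have := ler_norm (y - x); have := ler_norm (x - y); rewrite distrC ler_norml.
  by case: (ltP x b); case: (ltP y b) => *; apply/andP; split; lra.
have cf : continuous (f \o clamp).
  move=> x; apply/cvgrPdist_lt => /= e e0.
  have [d d0 H] := ac_uniform fac e0.
  near=> y; apply: H => //; apply: le_lt_trans (clamp1 _ _) _.
  by near: y; exact: cvgr_dist_lt.
have [c cab cmin] := EVT_min ab (continuous_subspaceT cf).
move: cab; rewrite in_itv/= => cab.
exists (f c) => [|x xab]; first exact: f0.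
by have := cmin x; rewrite in_itv/= => /(_ xab); rewrite /= !clampE.
Unshelve. all: by end_near. Qed.

Lemma acV f a b : a <= b -> abs_continuous a b f ->
  (forall x, a <= x <= b -> 0 < f x) -> abs_continuous a b (fun x => (f x)^-1).
Proof.
move=> ab fac f0; have [c c0 cf] := ac_lower_bound ab fac f0.
apply: (ac_dominated fac fac (K := c^-1 * c^-1)).
  by rewrite mulr_ge0// invr_ge0 ltW.
move=> s t sab tab; have ft := f0 _ tab; have fs := f0 _ sab.
have -> : (f t)^-1 - (f s)^-1 = - ((f t)^-1 * (f s)^-1 * (f t - f s)).
  by field; rewrite !gt_eqF.
rewrite normrN normrM; apply: ler_pM => //; last by rewrite lerDl.
rewrite normrM !gtr0_norm ?invr_gt0//.
by apply: ler_pM; rewrite ?invr_ge0 ?(ltW ft) ?(ltW fs)// lef_pV2 ?posrE// cf.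
Qed.

Lemma eq_ac f g a b : (forall x, a <= x <= b -> f x = g x) ->
  abs_continuous a b f -> abs_continuous a b g.
Proof.
move=> fg fac; apply: (ac_dominated fac fac ler01) => s t sab tab.
by rewrite mul1r !fg// lerDl.
Qed.

End AbsoluteContinuityClosure.

(** * Functions on a right neighbourhood of zero *)

Section RightNeighbourhoodOfZero.
Variable R : realType.
Implicit Types (f g h d df dg : R -> R) (e x y : R) (c : R) (n k : nat).
Local Notation mu := (@lebesgue_measure R).

Lemma lebesgue_aeS (P Q : R -> Prop) : (forall x, P x -> Q x) ->
  {ae mu, forall x, P x} -> {ae mu, forall x, Q x}.
Proof. exact: (@filterS _ _ (ae_filter_ringOfSetsType mu)). Qed.

Lemma lebesgue_aeS2 (P Q S : R -> Prop) : (forall x, P x -> Q x -> S x) ->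
  {ae mu, forall x, P x} -> {ae mu, forall x, Q x} -> {ae mu, forall x, S x}.
Proof. by move=> PQS; apply: (@filterS2 _ _ (ae_filter_ringOfSetsType mu)). Qed.

(** Absolute continuity is asked only on compact subintervals of the open interval: nothing is said
    at zero, where [tau] is known only through its limit and [h] may have no value of use. *)
Definition deriv_ae e f d :=
  (forall a b, 0 < a -> a <= b -> b < e -> abs_continuous a b f) /\
  {ae mu, forall x, 0 < x < e -> is_derive x 1 f (d x)}.

Definition tends_to0 f :=
  forall eps, 0 < eps -> exists2 delta, 0 < delta &
    forall x, 0 < x < delta -> `|f x| < eps.

Lemma deriv_ae_sub e e' f d : e' <= e -> deriv_ae e f d -> deriv_ae e' f d.
Proof.
move=> ee [fac fd]; split => [a b a0 ab be|].
  by apply: fac => //; exact: lt_le_trans be ee.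
apply: lebesgue_aeS fd => x H /andP[x0 xe]; apply: H.
by rewrite x0 (lt_le_trans xe).
Qed.

Lemma deriv_ae_eqd e f d d' : (forall x, 0 < x < e -> d x = d' x) ->
  deriv_ae e f d -> deriv_ae e f d'.
Proof.
move=> dd [fac fd]; split => //.
by apply: lebesgue_aeS fd => x H xe; rewrite -dd//; exact: H.
Qed.

Lemma deriv_aeD e f g df dg : deriv_ae e f df -> deriv_ae e g dg ->
  deriv_ae e (fun x => f x + g x) (fun x => df x + dg x).
Proof.
move=> [fac fd] [gac gd]; split => [a b a0 ab be|].
  by apply: acD; [exact: fac|exact: gac].
apply: lebesgue_aeS2 fd gd => x fx gx xe.
by apply: (is_deriveD (f := f) (g := g)); [exact: fx|exact: gx].
Qed.

Lemma deriv_aeN e f df : deriv_ae e f df ->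
  deriv_ae e (fun x => - f x) (fun x => - df x).
Proof.
move=> [fac fd]; split => [a b a0 ab be|].
  by apply: acN; exact: fac.
apply: lebesgue_aeS fd => x fx xe.
by apply: (is_deriveN (f := f)); exact: fx.
Qed.

Lemma deriv_aeB e f g df dg : deriv_ae e f df -> deriv_ae e g dg ->
  deriv_ae e (fun x => f x - g x) (fun x => df x - dg x).
Proof. by move=> fd /deriv_aeN gd; exact: deriv_aeD. Qed.

Lemma deriv_aeM e f g df dg : deriv_ae e f df -> deriv_ae e g dg ->
  deriv_ae e (fun x => f x * g x) (fun x => f x * dg x + df x * g x).
Proof.
move=> [fac fd] [gac gd]; split => [a b a0 ab be|].
  by apply: acM; [exact: fac|exact: gac].
apply: lebesgue_aeS2 fd gd => x fx gx xe; rewrite (mulrC (df x)).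
by apply: (is_deriveM (f := f) (g := g)); [exact: fx|exact: gx].
Qed.

Lemma deriv_ae_cst e c : deriv_ae e (fun=> c : R) (fun=> 0).
Proof.
split => [a b _ _ _|]; first exact: ac_cst.
by apply: aeW => x xe; exact: is_derive_cst.
Qed.

Lemma deriv_ae_id e : deriv_ae e id (fun=> 1).
Proof.
split => [a b _ _ _|]; first exact: ac_id.
by apply: aeW => x xe; exact: is_derive_id.
Qed.

Lemma deriv_aeZ e c f df : deriv_ae e f df ->
  deriv_ae e (fun x => c * f x) (fun x => c * df x).
Proof.
move=> fd; apply: deriv_ae_eqd (deriv_aeM (deriv_ae_cst e c) fd) => x _.
by rewrite mul0r addr0.
Qed.

(** Written with [n / x], the derivative needs no separate case [n = 0] and matches the singular
    coefficient of the system. *)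
Lemma deriv_ae_exp e n : deriv_ae e (fun x => x ^+ n) (fun x => n%:R / x * x ^+ n).
Proof.
elim: n => [|n IH].
  by apply: deriv_ae_eqd (deriv_ae_cst e 1) => x _; rewrite !mul0r.
have := deriv_aeM (deriv_ae_id e) IH; under eq_fun do rewrite -exprS.
apply: deriv_ae_eqd => x /andP[x0 _] /=.
by rewrite exprS -natr1; field; rewrite gt_eqF.
Qed.

Lemma deriv_ae_inv e n :
  deriv_ae e (fun x => x^-1 ^+ n) (fun x => - (n%:R / x * x^-1 ^+ n)).
Proof.
have inv1 : deriv_ae e (fun x => x^-1) (fun x => - (x^-1 * x^-1)).
  split => [a b a0 ab be|].
    apply: acV => //; first exact: ac_id.
    by move=> x /andP[ax _]; exact: lt_le_trans ax.
  apply: aeW => x /andP[x0 _].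
  have := is_deriveV (f := id) (lt0r_neq0 x0) (is_derive_id x 1).
  by rewrite /GRing.scale /= mulr1 expr2 invfM.
elim: n => [|n IH].
  by apply: deriv_ae_eqd (deriv_ae_cst e 1) => x _; rewrite !mul0r oppr0.
have := deriv_aeM inv1 IH; under eq_fun do rewrite -exprS.
apply: deriv_ae_eqd => x /andP[x0 _] /=.
by rewrite exprS -natr1; field; rewrite gt_eqF.
Qed.

Lemma deriv_ae_ge0_le_itv e f d x y : deriv_ae e f d ->
  0 < x -> x <= y -> y < e -> (forall z, x < z < y -> 0 <= d z) -> f x <= f y.
Proof.
move=> [fac fd] x0 xy ye d0; apply: ae_derive_ge0_le => //; first exact: fac.
apply: lebesgue_aeS fd => z H zxy; exists (d z); last exact: d0.
by move: zxy => /andP[xz zy]; apply: H; rewrite (lt_trans x0 xz) (lt_trans zy).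
Qed.

Lemma deriv_ae_ge0_le e f d x y : deriv_ae e f d ->
  (forall z, 0 < z < e -> 0 <= d z) -> 0 < x -> x <= y -> y < e -> f x <= f y.
Proof.
move=> fd d0 x0 xy ye; apply: (deriv_ae_ge0_le_itv fd) => // z /andP[xz zy].
by apply: d0; rewrite (lt_trans x0 xz) (lt_trans zy).
Qed.

(** A negative value would persist towards zero by monotonicity and contradict the limit. This
    stands in for integration from zero. *)
Lemma nondecreasing_tends_to0_ge0 e f d x : deriv_ae e f d ->
  (forall z, 0 < z < e -> 0 <= d z) -> tends_to0 f -> 0 < x < e -> 0 <= f x.
Proof.
move=> fd d0 f0 /andP[x0 xe]; rewrite leNgt; apply/negP; rewrite -oppr_gt0 => z0.
have [delta delta0 fdelta] := f0 _ z0.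
pose y := Num.min x (delta / 2).
have y0 : 0 < y by rewrite lt_min x0 divr_gt0.
have yx : y <= x by rewrite ge_min lexx.
have : `|f y| < - f x.
  by apply: fdelta; rewrite y0/= gt_min; apply/orP; right; lra.
rewrite ltr_norml opprK => /andP[+ _]; apply/negP; rewrite -leNgt.
exact: deriv_ae_ge0_le fd d0 y0 yx xe.
Qed.

Lemma tends_to0D f g : tends_to0 f -> tends_to0 g -> tends_to0 (fun x => f x + g x).
Proof.
move=> f0 g0 e e0; have e20 : 0 < e / 2 by rewrite divr_gt0.
have [d1 d10 H1] := f0 _ e20; have [d2 d20 H2] := g0 _ e20.
exists (Num.min d1 d2) => [|x /andP[x0]]; first by rewrite lt_min d10.
rewrite lt_min => /andP[x1 x2]; apply: (le_lt_trans (ler_normD _ _)).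
by rewrite (splitr e) ltrD// ?H1 ?H2 ?x0.
Qed.

Lemma tends_to0_le e f g : 0 < e ->
  (forall x, 0 < x < e -> `|f x| <= `|g x|) -> tends_to0 g -> tends_to0 f.
Proof.
move=> e0 fg g0 eps eps0; have [d d0 H] := g0 _ eps0.
exists (Num.min d e) => [|x /andP[x0]]; first by rewrite lt_min d0.
rewrite lt_min => /andP[xd xe]; apply: le_lt_trans (fg _ _) (H _ _); exact/andP.
Qed.

Lemma tends_to0Z c f : tends_to0 f -> tends_to0 (fun x => c * f x).
Proof.
move=> f0 e e0; have K0 : 0 < `|c| + 1 by rewrite ltr_wpDl.
have [d d0 H] := f0 _ (divr_gt0 e0 K0).
exists d => // x xd; rewrite normrM; have := H _ xd.
rewrite ltr_pdivlMr// mulrC; apply: le_lt_trans.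
by apply: ler_wpM2r => //; rewrite lerDl.
Qed.

Lemma tends_to0N f : tends_to0 f -> tends_to0 (fun x => - f x).
Proof. by move=> f0 e e0; have [d d0 H] := f0 _ e0; exists d => // x; rewrite normrN => /H. Qed.

Lemma tends_to0_exp n : tends_to0 (fun x => x ^+ n.+1).
Proof.
apply: (@tends_to0_le 1 _ id) => // [x /andP[x0 x1]|e e0].
  rewrite normrX exprS ler_piMr// exprn_ile1// gtr0_norm//; exact: ltW.
by exists e => // x /andP[x0 xe]; rewrite gtr0_norm.
Qed.

(** Both [L x^(k+1) + f] and [L x^(k+1) - f] are nondecreasing with limit zero, because [L x^k] is
    at most the derivative of [L x^(k+1)]. *)
Lemma deriv_ae_growth e f d k L : deriv_ae e f d -> tends_to0 f ->
  (forall x, 0 < x < e -> `|d x| <= L * x ^+ k) ->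
  forall x, 0 < x < e -> `|f x| <= L * x ^+ k.+1.
Proof.
move=> fd f0 dL x xe.
have Xd := deriv_aeZ L (deriv_ae_exp e k.+1).
have X0 := tends_to0Z L (tends_to0_exp k).
have dLz z : 0 < z < e ->
    `|d z| <= L * (k.+1%:R / z * z ^+ k.+1).
  move=> ze; apply: (le_trans (dL _ ze)).
  have -> : L * (k.+1%:R / z * z ^+ k.+1) = (L * z ^+ k) * k.+1%:R.
    by rewrite exprS; field; case/andP: ze => z0 _; rewrite gt_eqF.
  apply: ler_peMr; last by rewrite ler1n.
  exact: le_trans (normr_ge0 _) (dL _ ze).
rewrite ler_norml -subr_ge0 opprK -[X in _ && X]subr_ge0; apply/andP; split.
- apply: (nondecreasing_tends_to0_ge0 (deriv_aeD fd Xd)) => //.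
    move=> z ze; have := dLz _ ze; rewrite ler_norml => /andP[+ _]; lra.
  exact: tends_to0D.
- apply: (nondecreasing_tends_to0_ge0 (deriv_aeB Xd fd)) => //.
    move=> z ze; have := dLz _ ze; rewrite ler_norml => /andP[_ +]; lra.
  by apply: tends_to0D => //; exact: tends_to0N.
Qed.

End RightNeighbourhoodOfZero.

(** * A singular linear system near zero *)

Section SingularSystem.
Variables (R : realType) (e C : R) (n : nat).
Variables (a1 b1 a2 b2 ea1 eb1 ea2 eb2 tau : R -> R).
(** The pairs [(a1, b1)] and [(a2, b2)] are the real and imaginary parts of the components behaving
    like [x^n] and, potentially, [x^-n]. Thus [p] and [q] are squared moduli, and the [e] functions
    are the contributions of a bounded coefficient. *)
Let p x := a1 x ^+ 2 + b1 x ^+ 2.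
Let q x := a2 x ^+ 2 + b2 x ^+ 2.
Let size_h x := `|a1 x| + `|b1 x| + `|a2 x| + `|b2 x|.
Hypotheses (e_gt0 : 0 < e) (C_ge1 : 1 <= C).
Hypothesis a1d : deriv_ae e a1 (fun x => n%:R / x * a1 x + ea1 x).
Hypothesis b1d : deriv_ae e b1 (fun x => n%:R / x * b1 x + eb1 x).
Hypothesis a2d : deriv_ae e a2 (fun x => - (n%:R / x * a2 x) + ea2 x).
Hypothesis b2d : deriv_ae e b2 (fun x => - (n%:R / x * b2 x) + eb2 x).
Hypothesis taud : deriv_ae e tau (fun x => p x + q x).
Hypothesis e_le : forall x, 0 < x < e ->
  [/\ `|ea1 x| <= C * size_h x, `|eb1 x| <= C * size_h x,
      `|ea2 x| <= C * size_h x & `|eb2 x| <= C * size_h x].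
Hypothesis tau_gt0 : forall x, 0 < x < e -> 0 < tau x.
Hypothesis tau0 : tends_to0 tau.
Hypothesis regular0 : n = 0%N ->
  [/\ exists2 e1, 0 < e1 & forall x, 0 < x < e1 -> q x <= p x,
      tends_to0 a2 & tends_to0 b2].

Let u x := 2 * (a1 x * ea1 x + b1 x * eb1 x).
Let v x := 2 * (a2 x * ea2 x + b2 x * eb2 x).
(** By Cauchy-Schwarz [size_h ^+ 2] is at most [4 * (p + q)], so the error terms in the derivatives
    of [p] and [q] stay below [8 * C * (p + q)]; [D] leaves a factor two to spare. *)
Let D := 16 * C.

Let D_gt0 : 0 < D. Proof. by rewrite mulr_gt0// (lt_le_trans ltr01). Qed.

Let p_ge0 x : 0 <= p x. Proof. by rewrite addr_ge0 ?sqr_ge0. Qed.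
Let q_ge0 x : 0 <= q x. Proof. by rewrite addr_ge0 ?sqr_ge0. Qed.

Let pd : deriv_ae e p (fun x => 2 * n%:R / x * p x + u x).
Proof.
have := deriv_aeD (deriv_aeM a1d a1d) (deriv_aeM b1d b1d).
by apply: deriv_ae_eqd => x _; rewrite /p /u; ring.
Qed.

Let qd : deriv_ae e q (fun x => - (2 * n%:R / x * q x) + v x).
Proof.
have := deriv_aeD (deriv_aeM a2d a2d) (deriv_aeM b2d b2d).
by apply: deriv_ae_eqd => x _; rewrite /q /v; ring.
Qed.

Let cross_le (A B E F : R) x : `|A| + `|B| <= size_h x ->
  `|E| <= C * size_h x -> `|F| <= C * size_h x ->
  `|2 * (A * E + B * F)| <= D * (p x + q x).
Proof.
move=> AB EC FC; have C0 : 0 <= C by exact: le_trans ler01 C_ge1.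
have S2 : size_h x ^+ 2 <= 4 * (p x + q x).
  rewrite /size_h /p /q -(real_normK (num_real (a1 x))) -(real_normK (num_real (b1 x))).
  rewrite -(real_normK (num_real (a2 x))) -(real_normK (num_real (b2 x))).
  set A1 := `|a1 x|; set B1 := `|b1 x|; set A2 := `|a2 x|; set B2 := `|b2 x|.
  rewrite -subr_ge0.
  have -> : 4 * (A1 ^+ 2 + B1 ^+ 2 + (A2 ^+ 2 + B2 ^+ 2)) - (A1 + B1 + A2 + B2) ^+ 2 =
    (A1 - B1) ^+ 2 + (A1 - A2) ^+ 2 + (A1 - B2) ^+ 2 + (B1 - A2) ^+ 2 +
    (B1 - B2) ^+ 2 + (A2 - B2) ^+ 2 by ring.
  by rewrite !addr_ge0 ?sqr_ge0.
rewrite normrM ger0_norm//.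
have : `|A * E + B * F| <= (`|A| + `|B|) * (C * size_h x).
  apply: (le_trans (ler_normD _ _)); rewrite !normrM mulrDl.
  by apply: lerD; apply: ler_wpM2l.
have CS : 0 <= C * size_h x := le_trans (normr_ge0 _) EC.
have := ler_wpM2r CS AB.
have -> : size_h x * (C * size_h x) = C * size_h x ^+ 2 by ring.
have := ler_wpM2l C0 S2; rewrite /D.
have : 0 <= C * (p x + q x) by rewrite mulr_ge0// addr_ge0.
lra.
Qed.

Let u_le x : 0 < x < e -> `|u x| <= D * (p x + q x).
Proof.
move=> /e_le[h1 h2 _ _]; apply: cross_le => //.
by rewrite /size_h -addrA lerDl addr_ge0.
Qed.

Let v_le x : 0 < x < e -> `|v x| <= D * (p x + q x).
Proof.
move=> /e_le[_ _ h1 h2]; apply: cross_le => //.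
by rewrite /size_h -addrA lerDr addr_ge0.
Qed.

(** On the right half of the interval the derivative of [tau] is at least [d / x1], so [tau] gains
    [d / 2] there while being positive at the midpoint. This avoids the divergent logarithm. *)
Let tau_growth x1 d : 0 < x1 < e -> 0 < d ->
  (forall x, 0 < x < x1 -> d <= x * (p x + q x)) -> d / 2 <= tau x1.
Proof.
move=> /andP[x10 x1e] d0 dpq.
have Hd := deriv_aeB taud (deriv_aeZ (d / x1) (deriv_ae_id e)).
have half : 0 < x1 / 2 by rewrite divr_gt0.
have half_le : x1 / 2 <= x1 by lra.
have := deriv_ae_ge0_le_itv Hd half half_le x1e.
have -> : d / x1 * x1 = d by field; rewrite gt_eqF.
have -> : d / x1 * (x1 / 2) = d / 2 by field; rewrite gt_eqF.
have : 0 < tau (x1 / 2) by apply: tau_gt0; rewrite half (le_lt_trans half_le).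
suff : forall z, x1 / 2 < z < x1 -> 0 <= p z + q z - d / x1 * 1.
  by move=> H + /(_ H); lra.
move=> z /andP[z1 z2]; have z0 := lt_trans half z1.
rewrite mulr1 subr_ge0 ler_pdivrMr//; apply: (le_trans (dpq z _)); first by rewrite z0.
rewrite mulrC; apply: ler_wpM2l; last exact: ltW.
by rewrite addr_ge0.
Qed.

(* [x * (q x - p x)] is nonincreasing; if it were positive somewhere then
   [p x + q x >= d / x] near zero, which keeps [tau] away from [0]. *)
Let q_le_p : exists2 e1, 0 < e1 <= e & forall x, 0 < x < e1 -> q x <= p x.
Proof.
have [n0|n0] := eqVneq n 0%N.
  have [[e1 e10 qp] _ _] := regular0 n0.
  exists (Num.min e1 e); first by rewrite lt_min e10 e_gt0 ge_min lexx orbT.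
  by move=> x /andP[x0]; rewrite lt_min => /andP[xe1 _]; apply: qp; rewrite x0.
(* Here [z * D <= 1 / 2], so the error [z * (v z - u z)] is at most [p z + q z]. Since [n >= 1], the
   term [- 2 n (p + q)] absorbs it together with [q - p]. *)
pose e1 := Num.min e (2 * D)^-1.
have e1e : e1 <= e by rewrite ge_min lexx.
have e10 : 0 < e1 by rewrite lt_min e_gt0 invr_gt0 mulr_gt0.
exists e1; first by rewrite e10.
move=> x0 /andP[x00 x0e]; rewrite leNgt; apply/negP => pq.
pose d := x0 * (q x0 - p x0).
have d0 : 0 < d by rewrite mulr_gt0// subr_gt0.
have dle x : 0 < x < x0 -> d <= x * (p x + q x).
  move=> /andP[xp xx0].
  have Hd := deriv_aeN (deriv_ae_sub e1e (deriv_aeM (deriv_ae_id e) (deriv_aeB qd pd))).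
  have /(_ x x0) := deriv_ae_ge0_le Hd; rewrite xp ltW// x0e lerN2 => H.
  apply: (le_trans (H _ _ _ _)) => //; last first.
    apply: ler_wpM2l; first exact: ltW.
    by have := p_ge0 x; lra.
  move=> z /andP[z0 ze1]; rewrite mul1r /=.
  have ze : 0 < z < e by rewrite z0 (lt_le_trans ze1).
  have := u_le ze; have := v_le ze; rewrite !ler_norml => /andP[v1 v2] /andP[u1 u2].
  have zD : z * D <= 2^-1.
    have : z < (2 * D)^-1 by move: ze1; rewrite lt_min => /andP[].
    by rewrite invfM ltr_pdivlMr// => /ltW.
  have N1 : 1 <= n%:R :> R by rewrite ler1n lt0n.
  have -> : z * (- (2 * n%:R / z * q z) + v z - (2 * n%:R / z * p z + u z)) =
     - (2 * n%:R * (p z + q z)) + z * (v z - u z).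
    by field; rewrite gt_eqF.
  have pq0 : 0 <= p z + q z by rewrite addr_ge0.
  have : z * (v z - u z) <= z * (2 * (D * (p z + q z))).
    by apply: ler_wpM2l; [exact: ltW|lra].
  have := ler_wpM2r pq0 zD.
  have := ler_wpM2r pq0 N1.
  have := p_ge0 z; have := q_ge0 z.
  lra.
have [delta delta0 small] := tau0 (divr_gt0 d0 (ltr0Sn R 1)).
pose x1 := Num.min (x0 / 2) (delta / 2).
have x10 : 0 < x1 by rewrite lt_min !divr_gt0.
have x1x0 : x1 < x0 by rewrite gt_min; apply/orP; left; lra.
have x1d : x1 < delta by rewrite gt_min; apply/orP; right; lra.
have x1e : x1 < e by exact: lt_trans x1x0 (lt_le_trans x0e e1e).
have := small x1; rewrite x10 x1d => /(_ isT) /ltr_normlW.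
apply/negP; rewrite -leNgt; apply: tau_growth => //; first by rewrite x10.
by move=> x /andP[xp xx1]; apply: dle; rewrite xp (lt_trans xx1).
Qed.


(** Once [q <= p], the quotient [P = p / x^(2n)] satisfies [|P'| <= 2 D P]. The linear factors
    [1 + 4 D x] and [1 - 2 D x] make it nondecreasing and nonincreasing respectively, in place of
    the exponentials of Gronwall's inequality. *)
Let p_pinched : exists2 e2, 0 < e2 <= e & e2 <= 1 /\
  exists k K, [/\ 0 < k, 0 < K & forall x, 0 < x < e2 ->
    q x <= p x /\ k * x ^+ n ^+ 2 <= p x <= K * x ^+ n ^+ 2].
Proof.
have [e1 /andP[e10 e1e] qp] := q_le_p.
pose e3 := Num.min e1 (Num.min 1 (4 * D)^-1).
have e30 : 0 < e3 by rewrite !lt_min e10 ltr01 invr_gt0 mulr_gt0.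
have e3e1 : e3 <= e1 by rewrite ge_min lexx.
have e3e := le_trans e3e1 e1e.
have e31 : e3 <= 1 by rewrite !ge_min lexx orbT.
have e3D x : 0 < x < e3 -> 4 * (D * x) <= 1.
  move=> /andP[x0]; rewrite !lt_min => /andP[_ /andP[_ /ltW]].
  rewrite -[(4 * D)^-1]mul1r ler_pdivlMr; last exact: mulr_gt0.
  lra.
(* Otherwise [p] and [q] vanish near zero, and [tau] would be constant there with limit zero,
   against its positivity. *)
have [x2 x2e3 px2] : exists2 x2, 0 < x2 < e3 & 0 < p x2.
  apply: contrapT => H.
  have pq0 x : 0 < x < e3 -> p x + q x = 0.
    move=> xe; have pn : p x <= 0.
      by rewrite leNgt; apply/negP => px; apply: H; exists x.
    have : q x <= p x.
      by apply: qp; case/andP: xe => -> /lt_le_trans -> .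
    by have := p_ge0 x; have := q_ge0 x; lra.
  have Hd := deriv_aeN (deriv_ae_sub e3e taud).
  have e32 : 0 < e3 / 2 < e3 by apply/andP; split; lra.
  have := nondecreasing_tends_to0_ge0 Hd _ (tends_to0N tau0) e32.
  have : 0 < tau (e3 / 2).
    by apply: tau_gt0; case/andP: e32 => -> /lt_le_trans ->.
  suff H0 : forall z, 0 < z < e3 -> 0 <= - (p z + q z) by move=> + /(_ H0); lra.
  by move=> z /pq0 ->; rewrite oppr0.
have /andP[x20 x2lt] := x2e3.
pose P x := x^-1 ^+ n ^+ 2 * p x.
pose dP x := x^-1 ^+ n ^+ 2 * u x.
have Pd : deriv_ae e P dP.
  have inv2 := deriv_aeM (deriv_ae_inv e n) (deriv_ae_inv e n).
  have := deriv_aeM inv2 pd; apply: deriv_ae_eqd => x /andP[x0 _].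
  by rewrite /dP; ring.
have P_ge0 x : 0 <= P x by rewrite mulr_ge0// sqr_ge0.
have dP_le x : 0 < x < e3 -> `|dP x| <= 2 * (D * P x).
  move=> xe3; have xe : 0 < x < e by case/andP: xe3 => -> /lt_le_trans ->.
  rewrite normrM ger0_norm ?sqr_ge0//.
  have -> : 2 * (D * P x) = x^-1 ^+ n ^+ 2 * (D * (p x + p x)) by rewrite /P; ring.
  apply: ler_wpM2l; first exact: sqr_ge0.
  apply: (le_trans (u_le xe)); apply: ler_wpM2l; first exact: ltW.
  by rewrite lerD2l; apply: qp; case/andP: xe3 => -> /lt_le_trans ->.
have up x y : 0 < x -> x <= y -> y < e3 ->
    (1 + 4 * D * x) * P x <= (1 + 4 * D * y) * P y.
  have Hd := deriv_aeM (deriv_aeD (deriv_ae_cst e 1)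
    (deriv_aeZ (4 * D) (deriv_ae_id e))) Pd.
  apply: (deriv_ae_ge0_le (deriv_ae_sub e3e Hd)) => z ze3.
  have := dP_le _ ze3; rewrite ler_norml => /andP[dP1 _].
  have Dz := e3D _ ze3; have z0 : 0 < z by case/andP: ze3.
  have Dz0 : 0 <= D * z by rewrite mulr_ge0// ltW.
  have DP0 : 0 <= D * P z by rewrite mulr_ge0// ltW.
  have := ler_wpM2l Dz0 dP1.
  have : 0 <= D * P z * (1 - 4 * (D * z)) by rewrite mulr_ge0// subr_ge0.
  lra.
have down x y : 0 < x -> x <= y -> y < e3 ->
    (1 - 2 * D * y) * P y <= (1 - 2 * D * x) * P x.
  have Hd := deriv_aeN (deriv_aeM (deriv_aeB (deriv_ae_cst e 1)
    (deriv_aeZ (2 * D) (deriv_ae_id e))) Pd).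
  move=> x0 xy ye; rewrite -lerN2.
  apply: (deriv_ae_ge0_le (deriv_ae_sub e3e Hd)) => // z ze3.
  have := dP_le _ ze3; rewrite ler_norml => /andP[_ dP1].
  have Dz := e3D _ ze3; have z0 : 0 < z by case/andP: ze3.
  have Dz0 : 0 <= D * z by rewrite mulr_ge0// ltW.
  have DP0 : 0 <= D * P z by rewrite mulr_ge0// ltW.
  have Dz1 : 0 <= 1 - 2 * (D * z) by lra.
  have := ler_wpM2l Dz1 dP1.
  have : 0 <= D * P z * (D * z) by rewrite mulr_ge0.
  lra.
have PE x : 0 < x -> p x = P x * x ^+ n ^+ 2.
  move=> x0; rewrite /P mulrAC -!exprMn mulVf ?gt_eqF//.
  by rewrite !expr1n mul1r.
have Px2 : 0 < P x2 by rewrite mulr_gt0// !exprn_gt0// invr_gt0.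
exists x2; first by rewrite x20 (le_trans (ltW x2lt)).
split; first exact: le_trans (ltW x2lt) e31.
exists ((1 - 2 * D * x2) * P x2), ((1 + 4 * D * x2) * P x2).
have := e3D _ x2e3 => Dx2.
have Dx20 : 0 < D * x2 by rewrite mulr_gt0.
split; [by rewrite mulr_gt0//; lra|by rewrite mulr_gt0//; lra|].
move=> x /andP[x0 xx2]; have xe3 := lt_trans xx2 x2lt.
split; first by apply: qp; rewrite x0 (lt_le_trans xe3).
have xn0 : 0 <= x ^+ n ^+ 2 by rewrite sqr_ge0.
have Dx0 : 0 < D * x by rewrite mulr_gt0.
have DPx : 0 <= D * x * P x by rewrite mulr_ge0// ltW.
rewrite (PE _ x0); apply/andP; split; apply: ler_wpM2r => //.
  by apply: (le_trans (down _ _ x0 (ltW xx2) x2lt)); lra.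
by apply: le_trans (up _ _ x0 (ltW xx2) x2lt); lra.
Qed.

(** The integrating factor [x^n] removes the singular term: the derivative of [x^n f] is
    [x^n ef]. *)
Let e_growth e2 L k f ef : e2 <= e -> deriv_ae e f (fun x => - (n%:R / x * f x) + ef x) ->
  (forall x, 0 < x < e2 -> `|ef x| <= L * x ^+ k) ->
  tends_to0 (fun x => x ^+ n * f x) ->
  forall x, 0 < x < e2 -> `|x ^+ n * f x| <= L * x ^+ (n + k).+1.
Proof.
move=> e2e fd efL f0; apply: (deriv_ae_growth (d := fun x => x ^+ n * ef x)) => //.
  have := deriv_ae_sub e2e (deriv_aeM (deriv_ae_exp e n) fd).
  by apply: deriv_ae_eqd => x _; ring.
move=> x xe; have xn0 : 0 <= x ^+ n by rewrite exprn_ge0//; case/andP: xe => /ltW.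
by rewrite normrM ger0_norm// exprD mulrCA; apply: ler_wpM2l => //; exact: efL.
Qed.

(** All quantities are compared with powers of [x], and [tau] is bounded below by a multiple of
    [x^(2n+1)]. The gain of one power for the second component makes its products with the first of
    that order. *)
Lemma singular_asymptotics : exists2 e', 0 < e' <= e & exists K, forall x, 0 < x < e' ->
  [/\ `|(2 * n + 1)%:R * tau x - x * p x| <= K * (x * tau x), q x <= K * tau x &
  [/\ `|a1 x * a2 x| <= K * tau x, `|a1 x * b2 x| <= K * tau x,
      `|b1 x * a2 x| <= K * tau x & `|b1 x * b2 x| <= K * tau x]].
Proof.
have [e2 /andP[e20 e2e] [e21 [k [K [k0 K0 pK]]]]] := p_pinched.
have in_e x : 0 < x < e2 -> 0 < x < e by case/andP => -> /lt_le_trans ->.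
have C0 : 0 <= C by exact: le_trans ler01 C_ge1.
(* The inequality [K <= (1 + K) ^+ 2] replaces a square root of [K]. *)
pose K1 := 1 + K.
have sqr_le (f x : R) : 0 < x < e2 -> f ^+ 2 <= p x -> `|f| <= K1 * x ^+ n.
  move=> xe fp; have x0 : 0 <= x ^+ n by rewrite exprn_ge0//; case/andP: xe => /ltW.
  rewrite -ler_sqr ?nnegrE ?mulr_ge0//; last by rewrite /K1; lra.
  rewrite real_normK ?num_real//; apply: (le_trans fp).
  have [_ /andP[_ /le_trans]] := pK _ xe; apply.
  rewrite exprMn; apply: ler_wpM2r; first exact: sqr_ge0.
  by rewrite /K1 sqrrD expr1n mul1r -addrA [K *+ 2]mulr2n; have := sqr_ge0 K; lra.
have all_le x : 0 < x < e2 -> [/\ `|a1 x| <= K1 * x ^+ n, `|b1 x| <= K1 * x ^+ n,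
    `|a2 x| <= K1 * x ^+ n & `|b2 x| <= K1 * x ^+ n].
  move=> xe; have [qp _] := pK _ xe.
  by split; apply: sqr_le => //; [|  |apply: le_trans qp|apply: le_trans qp];
    rewrite /p /q ?lerDl ?lerDr sqr_ge0.
pose L := C * (4 * K1).
have L0 : 0 <= L by rewrite !mulr_ge0// /K1; lra.
have size_le x : 0 < x < e2 -> C * size_h x <= L * x ^+ n.
  move=> xe; rewrite /L -mulrA; apply: ler_wpM2l => //.
  by have [h1 h2 h3 h4] := all_le _ xe; rewrite /size_h; lra.
have f0 f : (n = 0%N -> tends_to0 f) ->
    (forall x, 0 < x < e2 -> `|f x| <= K1 * x ^+ n) -> tends_to0 (fun x => x ^+ n * f x).
  move=> f0 fK; have [n0|n0] := eqVneq n 0%N.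
    by apply: (tends_to0_le e20 _ (f0 n0)) => x _; rewrite n0 mul1r.
  have X0 := tends_to0Z K1 (@tends_to0_exp R n.-1).
  rewrite prednK ?lt0n// in X0; apply: (tends_to0_le e20 _ X0) => x xe.
  have /andP[x0 x1] := xe; rewrite normrM.
  apply: le_trans (_ : `|f x| <= _).
    by apply: ler_piMl => //; rewrite normrX exprn_ile1// gtr0_norm// ltW// (lt_le_trans x1).
  exact: le_trans (fK _ xe) (ler_norm _).
(* All components are already of order [x^n], hence so are the errors, and integration improves the
   second pair to order [x^(n+1)]. *)
have fast f ef : deriv_ae e f (fun x => - (n%:R / x * f x) + ef x) ->
    (n = 0%N -> tends_to0 f) ->
    (forall x, 0 < x < e2 -> `|f x| <= K1 * x ^+ n) ->
    (forall x, 0 < x < e2 -> `|ef x| <= C * size_h x) ->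
    forall x, 0 < x < e2 -> `|f x| <= L * x ^+ n.+1.
  move=> fd fn fK efC x xe.
  have efL z : 0 < z < e2 -> `|ef z| <= L * z ^+ n.
    by move=> ze; exact: le_trans (efC _ ze) (size_le _ ze).
  have := e_growth e2e fd efL (f0 _ fn fK) xe.
  have xn : 0 < x ^+ n by rewrite exprn_gt0//; case/andP: xe.
  by rewrite normrM gtr0_norm// -addnS exprD mulrCA ler_pM2l.
have a2L x : 0 < x < e2 -> `|a2 x| <= L * x ^+ n.+1.
  apply: (fast _ _ a2d) => [/regular0[]//|z /all_le[]//|z /in_e /e_le[]//].
have b2L x : 0 < x < e2 -> `|b2 x| <= L * x ^+ n.+1.
  apply: (fast _ _ b2d) => [/regular0[]//|z /all_le[]//|z /in_e /e_le[]//].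
pose N : R := (2 * n + 1)%:R.
have N1 : 1 <= N by rewrite ler1n addn1.
have NE : N = 2 * n%:R + 1 by rewrite /N natrD natrM.
have tau_lower x : 0 < x < e2 -> k / N * x ^+ (n + n).+1 <= tau x.
  move=> xe; rewrite -subr_ge0.
  have Hd := deriv_ae_sub e2e (deriv_aeB taud (deriv_aeZ (k / N) (deriv_ae_exp e (n + n).+1))).
  apply: (nondecreasing_tends_to0_ge0 Hd) xe => [z ze|]; last first.
    by apply: tends_to0D => //; apply/tends_to0N/tends_to0Z/tends_to0_exp.
  have [_ /andP[kp _]] := pK _ ze; have z0 : 0 < z by case/andP: ze.
  have -> : k / N * ((n + n).+1%:R / z * z ^+ (n + n).+1) = k * z ^+ n ^+ 2.
    rewrite exprS exprD -[(n + n).+1]addn1 addnn -mul2n -/N; field.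
    by rewrite !gt_eqF// (lt_le_trans ltr01).
  by have := q_ge0 z; lra.
have q_le x : 0 < x < e2 -> q x <= 2 * L ^+ 2 * x ^+ n.+1 ^+ 2.
  move=> xe; have x0 : 0 <= x by case/andP: xe => /ltW.
  have sq f : `|f| <= L * x ^+ n.+1 -> f ^+ 2 <= L ^+ 2 * x ^+ n.+1 ^+ 2.
    move=> fL; rewrite -exprMn -(real_normK (num_real f)).
    by rewrite ler_sqr ?nnegrE// mulr_ge0// exprn_ge0.
  by have := sq _ (a2L _ xe); have := sq _ (b2L _ xe); rewrite /q; lra.
(* With [N = 2 n + 1] the terms in [p] cancel in the derivative, leaving [N q - x u], which is of
   order [x^(2n+1)]. *)
pose T x := N * tau x - x * p x.
pose L' := N * (2 * L ^+ 2) + 2 * D * K.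
have L'0 : 0 <= L'.
  have N0 : 0 <= N := le_trans ler01 N1.
  have := ltW K0; have := ltW D_gt0; have LL := sqr_ge0 L => D0 K'0.
  by rewrite /L' addr_ge0//; do ![apply: mulr_ge0 => //].
have T_le : forall x, 0 < x < e2 -> `|T x| <= L' * x ^+ (n + n).+2.
  apply: (deriv_ae_growth (d := fun x => N * q x - x * u x)).
  - have := deriv_ae_sub e2e (deriv_aeB (deriv_aeZ N taud) (deriv_aeM (deriv_ae_id e) pd)).
    apply: deriv_ae_eqd => x /andP[x0 _]; rewrite NE; field.
    by rewrite gt_eqF.
  - apply: tends_to0D; first exact: tends_to0Z.
    apply: tends_to0N; have X0 := tends_to0Z K (@tends_to0_exp R 0).
    apply: (tends_to0_le e20 _ X0) => x xe.
    have [_ /andP[_ pKx]] := pK _ xe; have /andP[x0 x1] := xe.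
    rewrite !normrM expr1 (gtr0_norm K0) mulrC; apply: ler_wpM2r => //.
    rewrite ger0_norm//; apply: (le_trans pKx); apply: ler_piMr; first exact: ltW.
    by rewrite -exprM exprn_ile1// ?ltW// (lt_le_trans x1).
  - move=> x xe; have /andP[x0 x1] := xe; have xn : 0 <= x ^+ n ^+ 2 by exact: sqr_ge0.
    have [qp /andP[_ pKx]] := pK _ xe.
    have uK : `|u x| <= 2 * D * K * x ^+ n ^+ 2.
      apply: (le_trans (u_le (in_e _ xe))).
      have -> : 2 * D * K * x ^+ n ^+ 2 = D * (2 * (K * x ^+ n ^+ 2)) by ring.
      by apply: ler_wpM2l; [exact: ltW|lra].
    apply: (le_trans (ler_normB _ _)); rewrite (normrM N) (normrM x) (gtr0_norm x0).
    rewrite (ger0_norm (q_ge0 x)) (@ger0_norm _ N); last exact: le_trans N1.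
    have -> : L' * x ^+ (n + n).+1 = N * (2 * L ^+ 2 * (x * x ^+ n ^+ 2)) + x * (2 * D * K * x ^+ n ^+ 2).
      by rewrite /L' [x ^+ _.+1]exprS exprD; ring.
    apply: lerD; last by apply: ler_wpM2l => //; exact: ltW.
    apply: ler_wpM2l; first exact: le_trans N1.
    apply: (le_trans (q_le _ xe)); apply: ler_wpM2l; first by rewrite mulr_ge0// sqr_ge0.
    rewrite [x ^+ n.+1]exprS exprMn expr2 -mulrA ler_wpM2l//; first exact: ltW.
    by apply: ler_piMl => //; exact: le_trans (ltW x1) e21.
have kN : 0 < k / N by rewrite divr_gt0// (lt_le_trans ltr01).
have tau_bound (A B x : R) : 0 < x < e2 -> 0 <= B -> A <= B * x ^+ (n + n).+1 ->
    A <= B / (k / N) * tau x.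
  move=> xe B0 /le_trans; apply; rewrite -mulrA; apply: ler_wpM2l => //.
  by rewrite mulrC ler_pdivlMr// mulrC; exact: tau_lower.
have K10 : 0 <= K1 by rewrite /K1; lra.
pose M := L' + 2 * L ^+ 2 + K1 * L.
have [LL0 KL0] : 0 <= 2 * L ^+ 2 /\ 0 <= K1 * L.
  by split; rewrite mulr_ge0// sqr_ge0.
have M0 : 0 <= M by rewrite /M; lra.
exists e2; first by rewrite e20.
exists (M / (k / N)) => x xe; have x0 : 0 < x by case/andP: xe.
have x1 : x <= 1 by case/andP: xe => _ /ltW /le_trans; exact.
have X0 : 0 <= x ^+ (n + n).+1 by rewrite exprn_ge0// ltW.
have [h1 h2 h3 h4] := all_le _ xe.
have cross f g : `|f| <= K1 * x ^+ n -> `|g| <= L * x ^+ n.+1 ->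
    `|f * g| <= M / (k / N) * tau x.
  move=> fK gL; apply: tau_bound => //; rewrite normrM.
  apply: (le_trans (ler_pM (normr_ge0 _) (normr_ge0 _) fK gL)).
  have -> : K1 * x ^+ n * (L * x ^+ n.+1) = K1 * L * x ^+ (n + n).+1.
    by rewrite -addnS exprD; ring.
  by apply: ler_wpM2r => //; rewrite /M; lra.
split; last by split; apply: cross => //; [exact: a2L|exact: b2L|exact: a2L|exact: b2L].
- have -> : M / (k / N) * (x * tau x) = x * (M / (k / N) * tau x) by ring.
  rewrite -ler_pdivrMl//; apply: tau_bound => //; rewrite ler_pdivrMl//.
  apply: (le_trans (T_le _ xe)); rewrite exprS mulrCA; apply: ler_wpM2l; first exact: ltW.
  by apply: ler_wpM2r => //; rewrite /M; lra.
- apply: tau_bound => //; apply: (le_trans (q_le _ xe)).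
  apply: (@le_trans _ _ (2 * L ^+ 2 * x ^+ (n + n).+1)); last first.
    by apply: ler_wpM2r => //; rewrite /M; lra.
  apply: ler_wpM2l => //; rewrite -exprM mulnC mul2n -addnn addSn addnS exprS.
  exact: ler_piMl.
Qed.

End SingularSystem.

(** * Complex and matrix calculus *)

Section ComplexCalculus.
Variable R : realType.
Local Notation C := R[i].
Local Notation Re := (@complex.Re R).
Local Notation Im := (@complex.Im R).
Implicit Types (z w : C) (f g : R -> C) (x a b : R).

Lemma cxReD z w : Re (z + w) = Re z + Re w. Proof. by case: z w => ? ? []. Qed.
Lemma cxImD z w : Im (z + w) = Im z + Im w. Proof. by case: z w => ? ? []. Qed.
Lemma cxReN z : Re (- z) = - Re z. Proof. by case: z. Qed.
Lemma cxImN z : Im (- z) = - Im z. Proof. by case: z. Qed.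
Lemma cxReM z w : Re (z * w) = Re z * Re w - Im z * Im w.
Proof. by case: z w => ? ? []. Qed.
Lemma cxImM z w : Im (z * w) = Re z * Im w + Im z * Re w.
Proof. by case: z w => ? ? []. Qed.
Lemma cxReV z : Re z^-1 = Re z * (Re z ^+ 2 + Im z ^+ 2)^-1. Proof. by case: z. Qed.
Lemma cxImV z : Im z^-1 = - Im z * (Re z ^+ 2 + Im z ^+ 2)^-1.
Proof. by case: z => a b /=; rewrite mulNr. Qed.
Lemma cxRe_conj z : Re (Num.conj z) = Re z. Proof. by case: z. Qed.
Lemma cxIm_conj z : Im (Num.conj z) = - Im z. Proof. by case: z. Qed.

Lemma sqr_ReIm_gt0 z : z != 0 -> 0 < Re z ^+ 2 + Im z ^+ 2.
Proof.
rewrite eq_complex /= negb_and => /orP[]z0; [rewrite ltr_wpDr|rewrite ltr_wpDl];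
  by rewrite ?sqr_ge0// exprn_even_gt0.
Qed.

(** This is what an entry of [mx_is_derive] unfolds to, so results on scalars pass to matrices by
    conversion. *)
Definition cx_derive f x z :=
  is_derive x 1 (Re \o f) (Re z) /\ is_derive x 1 (Im \o f) (Im z).

Definition cx_ac a b f := abs_continuous a b (Re \o f) /\ abs_continuous a b (Im \o f).

Lemma is_derive_ext (u v : R -> R) x (d e : R) :
  is_derive x 1 u d -> u = v -> d = e -> is_derive x 1 v e.
Proof. by move=> + <- <-. Qed.

Lemma cx_derive_cst z x : cx_derive (fun=> z) x 0.
Proof. by split; exact: is_derive_cst. Qed.

Lemma cx_deriveD f g x z w : cx_derive f x z -> cx_derive g x w ->
  cx_derive (fun y => f y + g y) x (z + w).
Proof.
move=> [fr fi] [gr gi]; split.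
  apply: (is_derive_ext (is_deriveD fr gr)); last by rewrite cxReD.
  by apply/funext => y /=; rewrite cxReD.
apply: (is_derive_ext (is_deriveD fi gi)); last by rewrite cxImD.
by apply/funext => y /=; rewrite cxImD.
Qed.

Lemma cx_deriveN f x z : cx_derive f x z -> cx_derive (fun y => - f y) x (- z).
Proof.
move=> [fr fi]; split.
  apply: (is_derive_ext (is_deriveN fr)); last by rewrite cxReN.
  by apply/funext => y /=; rewrite cxReN.
apply: (is_derive_ext (is_deriveN fi)); last by rewrite cxImN.
by apply/funext => y /=; rewrite cxImN.
Qed.

Lemma cx_derive_conj f x z : cx_derive f x z ->
  cx_derive (fun y => Num.conj (f y)) x (Num.conj z).
Proof.
move=> [fr fi]; split.
  apply: (is_derive_ext fr); last by rewrite cxRe_conj.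
  by apply/funext => y /=; rewrite cxRe_conj.
apply: (is_derive_ext (is_deriveN fi)); last by rewrite cxIm_conj.
by apply/funext => y /=; rewrite cxIm_conj.
Qed.

Lemma cx_deriveM f g x z w : cx_derive f x z -> cx_derive g x w ->
  cx_derive (fun y => f y * g y) x (z * g x + f x * w).
Proof.
move=> [fr fi] [gr gi]; split.
  apply: (is_derive_ext (is_deriveB (is_deriveM fr gr) (is_deriveM fi gi))).
    by apply/funext => y /=; rewrite cxReM.
  by rewrite cxReD !cxReM /GRing.scale /=; ring.
apply: (is_derive_ext (is_deriveD (is_deriveM fr gi) (is_deriveM fi gr))).
  by apply/funext => y /=; rewrite cxImM.
by rewrite cxImD !cxImM /GRing.scale /=; ring.
Qed.

(** Mere existence is enough, here and for determinants: the derivative of an inverse matrix is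
    identified later by the product rule. *)
Lemma cx_derivable_inv f x z : cx_derive f x z -> f x != 0 ->
  exists w, cx_derive (fun y => (f y)^-1) x w.
Proof.
move=> [fr fi] fx0.
have sq := is_deriveD (is_deriveM fr fr) (is_deriveM fi fi).
have sq0 : ((Re \o f) * (Re \o f) + (Im \o f) * (Im \o f)) x != 0.
  by rewrite gt_eqF//; have := sqr_ReIm_gt0 fx0; rewrite !expr2.
have sqV := is_deriveV sq0 sq.
have dr := is_deriveM fr sqV; have di := is_deriveM (is_deriveN fi) sqV.
eexists (_ +i* _); split.
  apply: (is_derive_ext dr) => //=.
  by apply/funext => y /=; rewrite cxReV !expr2.
apply: (is_derive_ext di) => //=.
by apply/funext => y /=; rewrite cxImV !expr2.
Qed.

Lemma cx_derive_sum (I : finType) (F : I -> R -> C) (G : I -> C) x :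
  (forall i, cx_derive (F i) x (G i)) ->
  cx_derive (fun y => \sum_i F i y) x (\sum_i G i).
Proof.
move=> FG.
have key (s : seq I) : cx_derive (fun y => \sum_(i <- s) F i y) x (\sum_(i <- s) G i).
  elim: s => [|i s IH].
    under eq_fun do rewrite big_nil; rewrite big_nil; exact: cx_derive_cst.
  by under eq_fun do rewrite big_cons; rewrite big_cons; exact: cx_deriveD.
exact: key.
Qed.

Lemma cx_derivable_prod (I : finType) (F : I -> R -> C) x :
  (forall i, exists z, cx_derive (F i) x z) ->
  exists z, cx_derive (fun y => \prod_i F i y) x z.
Proof.
move=> FG.
have key (s : seq I) : exists z, cx_derive (fun y => \prod_(i <- s) F i y) x z.
  elim: s => [|i s [w IH]].
    by exists 0; under eq_fun do rewrite big_nil; exact: cx_derive_cst.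
  have [z Fz] := FG i; eexists; under eq_fun do rewrite big_cons.
  exact: cx_deriveM Fz IH.
exact: key.
Qed.

Lemma cx_ac_cst a b z : cx_ac a b (fun=> z).
Proof. by split; exact: ac_cst. Qed.

Lemma cx_acD a b f g : cx_ac a b f -> cx_ac a b g -> cx_ac a b (fun y => f y + g y).
Proof.
move=> [fr fi] [gr gi]; split.
  by apply: eq_ac (acD fr gr) => x _ /=; rewrite cxReD.
by apply: eq_ac (acD fi gi) => x _ /=; rewrite cxImD.
Qed.

Lemma cx_acN a b f : cx_ac a b f -> cx_ac a b (fun y => - f y).
Proof.
move=> [fr fi]; split.
  by apply: eq_ac (acN fr) => x _ /=; rewrite cxReN.
by apply: eq_ac (acN fi) => x _ /=; rewrite cxImN.
Qed.

Lemma cx_ac_conj a b f : cx_ac a b f -> cx_ac a b (fun y => Num.conj (f y)).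
Proof.
move=> [fr fi]; split.
  by apply: eq_ac fr => x _ /=; rewrite cxRe_conj.
by apply: eq_ac (acN fi) => x _ /=; rewrite cxIm_conj.
Qed.

Lemma cx_acM a b f g : cx_ac a b f -> cx_ac a b g -> cx_ac a b (fun y => f y * g y).
Proof.
move=> [fr fi] [gr gi]; split.
  by apply: eq_ac (acB (acM fr gr) (acM fi gi)) => x _ /=; rewrite cxReM.
by apply: eq_ac (acD (acM fr gi) (acM fi gr)) => x _ /=; rewrite cxImM.
Qed.

Lemma cx_acV a b f : a <= b -> cx_ac a b f -> (forall x, a <= x <= b -> f x != 0) ->
  cx_ac a b (fun y => (f y)^-1).
Proof.
move=> ab [fr fi] f0.
have sqV : abs_continuous a b (fun x => (Re (f x) ^+ 2 + Im (f x) ^+ 2)^-1).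
  apply: acV => // [|x /f0]; last exact: sqr_ReIm_gt0.
  by apply: eq_ac (acD (acM fr fr) (acM fi fi)) => x _ /=; rewrite !expr2.
split.
  by apply: eq_ac (acM fr sqV) => x _ /=; rewrite cxReV.
by apply: eq_ac (acM (acN fi) sqV) => x _ /=; rewrite cxImV.
Qed.

Lemma cx_ac_sum a b (I : finType) (F : I -> R -> C) :
  (forall i, cx_ac a b (F i)) -> cx_ac a b (fun y => \sum_i F i y).
Proof.
move=> FG; have key (s : seq I) : cx_ac a b (fun y => \sum_(i <- s) F i y).
  elim: s => [|i s IH]; first by under eq_fun do rewrite big_nil; exact: cx_ac_cst.
  by under eq_fun do rewrite big_cons; exact: cx_acD.
exact: key.
Qed.

Lemma cx_ac_prod a b (I : finType) (F : I -> R -> C) :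
  (forall i, cx_ac a b (F i)) -> cx_ac a b (fun y => \prod_i F i y).
Proof.
move=> FG; have key (s : seq I) : cx_ac a b (fun y => \prod_(i <- s) F i y).
  elim: s => [|i s IH]; first by under eq_fun do rewrite big_nil; exact: cx_ac_cst.
  by under eq_fun do rewrite big_cons; exact: cx_acM.
exact: key.
Qed.

Lemma eq_cx_ac a b f g : (forall x, a <= x <= b -> f x = g x) -> cx_ac a b f -> cx_ac a b g.
Proof. by move=> fg [fr fi]; split; [apply: eq_ac fr|apply: eq_ac fi] => x /= /fg ->. Qed.

Lemma cx_derive_ext f g x z w : cx_derive f x z -> f =1 g -> z = w -> cx_derive g x w.
Proof. by move=> + /funext <- <-. Qed.

Lemma eq_cx_derive f g x z : (\near x, f x = g x) -> cx_derive f x z -> cx_derive g x z.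
Proof.
move=> fg [fr fi]; split; [apply: near_eq_is_derive fr|apply: near_eq_is_derive fi];
  by apply: filterS fg => y /= ->.
Qed.

End ComplexCalculus.

(** * Differentiation and absolute continuity of matrix functions *)

Section MatrixCalculus.
Variable R : realType.
Local Notation C := R[i].
Implicit Types (x a b : R).

Definition mx_ac p q a b (F : R -> 'M[C]_(p, q)) :=
  forall i j, cx_ac a b (fun y => F y i j).

Lemma adjM p q r (A : 'M[C]_(p, q)) (B : 'M[C]_(q, r)) :
  (A *m B) ^t* = B ^t* *m A ^t*.
Proof. by rewrite trmx_mul map_mxM. Qed.

Lemma adjD p q (A B : 'M[C]_(p, q)) : (A + B) ^t* = A ^t* + B ^t*.
Proof. by apply/matrixP => i j; rewrite !mxE rmorphD. Qed.

Lemma adjN p q (A : 'M[C]_(p, q)) : (- A) ^t* = - A ^t*.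
Proof. by apply/matrixP => i j; rewrite !mxE rmorphN. Qed.

Lemma adjB p q (A B : 'M[C]_(p, q)) : (A - B) ^t* = A ^t* - B ^t*.
Proof. by rewrite adjD adjN. Qed.

Lemma mx_derive_cst p q (A : 'M[C]_(p, q)) x : mx_is_derive (fun=> A) x 0.
Proof. by move=> i j; rewrite mxE; exact: cx_derive_cst. Qed.

Lemma mx_deriveD p q (F G : R -> 'M[C]_(p, q)) x DF DG :
  mx_is_derive F x DF -> mx_is_derive G x DG ->
  mx_is_derive (fun y => F y + G y) x (DF + DG).
Proof.
by move=> FD GD i j; apply: cx_derive_ext (cx_deriveD (FD i j) (GD i j)) _ _ => [y|]; rewrite mxE.
Qed.

Lemma mx_deriveN p q (F : R -> 'M[C]_(p, q)) x DF :
  mx_is_derive F x DF -> mx_is_derive (fun y => - F y) x (- DF).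
Proof.
by move=> FD i j; apply: cx_derive_ext (cx_deriveN (FD i j)) _ _ => [y|]; rewrite mxE.
Qed.

Lemma mx_deriveB p q (F G : R -> 'M[C]_(p, q)) x DF DG :
  mx_is_derive F x DF -> mx_is_derive G x DG ->
  mx_is_derive (fun y => F y - G y) x (DF - DG).
Proof. by move=> FD /mx_deriveN GD; exact: mx_deriveD. Qed.

Lemma mx_deriveM p q r (F : R -> 'M[C]_(p, q)) (G : R -> 'M[C]_(q, r)) x DF DG :
  mx_is_derive F x DF -> mx_is_derive G x DG ->
  mx_is_derive (fun y => F y *m G y) x (DF *m G x + F x *m DG).
Proof.
move=> FD GD i j.
apply: cx_derive_ext (cx_derive_sum (fun k => cx_deriveM (FD i k) (GD k j))) _ _ => [y|].
  by rewrite mxE.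
by rewrite big_split !mxE.
Qed.

Lemma mx_derive_adj p q (F : R -> 'M[C]_(p, q)) x DF :
  mx_is_derive F x DF -> mx_is_derive (fun y => (F y) ^t*) x (DF ^t*).
Proof.
by move=> FD i j; apply: cx_derive_ext (cx_derive_conj (FD j i)) _ _ => [y|]; rewrite !mxE.
Qed.

Lemma mx_acM p q r a b (F : R -> 'M[C]_(p, q)) (G : R -> 'M[C]_(q, r)) :
  mx_ac a b F -> mx_ac a b G -> mx_ac a b (fun y => F y *m G y).
Proof.
move=> FD GD i j.
apply: eq_cx_ac (cx_ac_sum (fun k => cx_acM (FD i k) (GD k j))) => x _.
by rewrite !mxE.
Qed.

Lemma mx_ac_cst p q a b (A : 'M[C]_(p, q)) : mx_ac a b (fun=> A).
Proof. by move=> i j; exact: cx_ac_cst. Qed.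

Lemma mx_acD p q a b (F G : R -> 'M[C]_(p, q)) :
  mx_ac a b F -> mx_ac a b G -> mx_ac a b (fun y => F y + G y).
Proof. by move=> FD GD i j; apply: eq_cx_ac (cx_acD (FD i j) (GD i j)) => x _; rewrite mxE. Qed.

Lemma mx_acN p q a b (F : R -> 'M[C]_(p, q)) :
  mx_ac a b F -> mx_ac a b (fun y => - F y).
Proof. by move=> FD i j; apply: eq_cx_ac (cx_acN (FD i j)) => x _; rewrite mxE. Qed.

Lemma mx_acB p q a b (F G : R -> 'M[C]_(p, q)) :
  mx_ac a b F -> mx_ac a b G -> mx_ac a b (fun y => F y - G y).
Proof. by move=> FD /mx_acN GD; exact: mx_acD. Qed.

Lemma mx_ac_adj p q a b (F : R -> 'M[C]_(p, q)) :
  mx_ac a b F -> mx_ac a b (fun y => (F y) ^t*).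
Proof. by move=> FD i j; apply: eq_cx_ac (cx_ac_conj (FD j i)) => x _; rewrite !mxE. Qed.

Lemma det_derivable n (F : R -> 'M[C]_n) x :
  (forall i j, exists z, cx_derive (fun y => F y i j) x z) ->
  exists z, cx_derive (fun y => \det (F y)) x z.
Proof.
move=> FD; pose G (s : 'S_n) y : C := (-1) ^+ s * \prod_i F y i (s i).
have /choice[z Gz] : forall s, exists z, cx_derive (G s) x z.
  move=> s; have [z Hz] := cx_derivable_prod (F := fun i y => F y i (s i)) (fun i => FD i (s i)).
  exists (0 * \prod_i F x i (s i) + (-1) ^+ s * z).
  exact: cx_deriveM (cx_derive_cst _ _) Hz.
by exists (\sum_s z s); exact: cx_derive_sum Gz.
Qed.

Lemma det_ac n a b (F : R -> 'M[C]_n) : mx_ac a b F -> cx_ac a b (fun y => \det (F y)).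
Proof.
move=> FD; apply: cx_ac_sum => s; apply: cx_acM; first exact: cx_ac_cst.
by apply: cx_ac_prod => i; exact: FD.
Qed.

Lemma mx_ac_inv n a b (F : R -> 'M[C]_n) : a <= b -> mx_ac a b F ->
  (forall x, a <= x <= b -> F x \in unitmx) -> mx_ac a b (fun y => invmx (F y)).
Proof.
move=> ab FD Fu i j.
have detV : cx_ac a b (fun y => (\det (F y))^-1).
  by apply: (cx_acV ab (det_ac FD)) => x /Fu; rewrite unitmxE unitfE.
have cof : cx_ac a b (fun y => cofactor (F y) j i).
  apply: cx_acM; first exact: cx_ac_cst.
  by apply: det_ac => k k'; apply: eq_cx_ac (FD (lift j k) (lift i k')) => y _; rewrite !mxE.
by apply: eq_cx_ac (cx_acM detV cof) => x /Fu Fx; rewrite /invmx Fx !mxE.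
Qed.

(** Cofactors and the determinant show that the inverse is differentiable; differentiating
    [invmx F *m F = 1] gives the value. Invertibility is needed near [x], since [invmx] returns a
    singular matrix unchanged. *)
Lemma mx_derive_inv n (F : R -> 'M[C]_n) x DF : mx_is_derive F x DF ->
  (\near x, F x \in unitmx) ->
  mx_is_derive (fun y => invmx (F y)) x (- (invmx (F x) *m DF *m invmx (F x))).
Proof.
move=> FD Fu; have Fx := nbhs_singleton Fu.
have dF i j : exists z, cx_derive (fun y => F y i j) x z by eexists; exact: FD.
have [d detD] := det_derivable dF.
have det0 : \det (F x) != 0 by move: Fx; rewrite unitmxE unitfE.
have [w detV] := cx_derivable_inv detD det0.
have ex i j : exists z, cx_derive (fun y => invmx (F y) i j) x z.
  have [z cofD] : exists z, cx_derive (fun y => cofactor (F y) j i) x z.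
    have [k k'|z Hz] := @det_derivable _ (fun y => row' j (col' i (F y))) x.
      have [z Hz] := dF (lift j k) (lift i k'); exists z.
      by apply: cx_derive_ext Hz _ _ => // y; rewrite !mxE.
    by eexists; exact: cx_deriveM (cx_derive_cst _ _) Hz.
  eexists; apply: eq_cx_derive (cx_deriveM detV cofD).
  by apply: filterS Fu => y Fy; rewrite /invmx Fy !mxE.
have /choice[G GD] : forall i, exists G : 'I_n -> C, forall j,
    cx_derive (fun y => invmx (F y) i j) x (G j).
  by move=> i; have /choice[g Hg] := ex i; exists g.
pose D : 'M[C]_n := \matrix_(i, j) G i j.
have invD : mx_is_derive (fun y => invmx (F y)) x D.
  by move=> i j; rewrite mxE; exact: GD.
suff -> : - (invmx (F x) *m DF *m invmx (F x)) = D by [].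
have prodD := mx_deriveM invD FD.
have cstD : mx_is_derive (fun y => invmx (F y) *m F y) x 0.
  move=> i j; apply: eq_cx_derive (mx_derive_cst 1%:M x i j).
  by apply: filterS Fu => y Fy; rewrite mulVmx.
(* The product rule and the constancy of the product give two derivatives of the same function;
   uniqueness equates them. *)
have D0 : D *m F x + invmx (F x) *m DF = 0.
  apply/matrixP => i j; have [p1 p2] := prodD i j; have [c1 c2] := cstD i j.
  have e1 := @derive_val _ _ _ _ _ _ _ p1; rewrite (@derive_val _ _ _ _ _ _ _ c1) in e1.
  have e2 := @derive_val _ _ _ _ _ _ _ p2; rewrite (@derive_val _ _ _ _ _ _ _ c2) in e2.
  by apply/eqP; rewrite eq_complex -e1 -e2 !eqxx.
rewrite -mulNmx; apply: (can_inj (mulmxK Fx)).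
have /eqP := D0; rewrite addr_eq0 => /eqP <-.
by rewrite mulmxKV.
Qed.

End MatrixCalculus.

(** * Algebra of the Darboux transformation *)

(** Products become opaque variables and the entries are left to [ring]. It proves identities that
    are additive once [mx_expand] has brought all products to one association. *)
Ltac mx_abel :=
  repeat match goal with
  | |- context [mulmx ?A ?B] => let M := fresh "M" in set M := mulmx A B; move: M => M
  end;
  apply/matrixP => ? ?; rewrite !mxE; ring.

Ltac mx_expand := rewrite ?(mulmxDl, mulmxDr, mulmxBl, mulmxBr, mulNmx, mulmxN,
  mul1mx, mulmx1, mulmxA, opprK, mul0mx, mulmx0).

Section GBDTAlgebra.
Variable R : realType.
Local Notation C := R[i].
Local Notation J := (@breveJ R).

Lemma mulJJ : J *m J = - 1%:M.
Proof.
apply/matrixP => i j; rewrite !mxE !big_ord_recl big_ord0 !mxE.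
by case: i j => [[|[|[]]] i2] // [[|[|[]]] j2] //=; rewrite -?val_eqE /=; ring.
Qed.

Lemma adjJ : J ^t* = - J.
Proof.
apply/matrixP => i j; rewrite !mxE.
by case: i j => [[|[|[]]] i2] // [[|[|[]]] j2] //=; rewrite -?val_eqE /=
  ?rmorphN ?rmorph1 ?rmorph0 ?oppr0 ?opprK.
Qed.

(** Equivalently, [Q *m J] is Hermitian: [Q] is an infinitesimal isometry of the form [J]. For [q0]
    this expresses that its coefficients are real, and the transformation preserves the class. *)
Definition J_antisymmetric (Q : 'M[C]_2) := Q *m J + J *m Q ^t* = 0.

Lemma q0_J_antisymmetric va ve vs (x : R) : J_antisymmetric (q0 va ve vs x).
Proof.
apply/matrixP => i j; rewrite /q0 !mxE !big_ord_recl !big_ord0 !mxE.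
rewrite !big_ord_recl !big_ord0 !mxE.
case: i j => [[|[|[]]] i2] // [[|[|[]]] j2] //=; rewrite -?val_eqE /=; 
  apply/eqP; rewrite eq_complex /=; apply/andP; split; apply/eqP; ring.
Qed.

Section Identity.
Variables (n : nat) (A S : 'M[C]_n) (P : 'M[C]_(n, 2)).
Hypothesis Su : S \in unitmx.
Hypothesis idS : A *m S - S *m A ^t* = P *m J *m P ^t*.
Let B := invmx S *m P.
Let X := P ^t* *m invmx S *m P.

(** Multiplying the identity by [invmx S] on both sides trades [A] on the right of [invmx S] for
    [A ^t*] on its left. *)
Lemma inv_mul_A : invmx S *m A *m P = A ^t* *m B + B *m J *m X.
Proof.
have : A *m S = S *m A ^t* + P *m J *m P ^t* by rewrite -idS addrC subrK.
move/(congr1 (fun M => invmx S *m (M *m (invmx S *m P)))).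
rewrite -!mulmxA mulKVmx// => ->; rewrite mulmxDl mulmxDr /B /X.
by rewrite -!mulmxA mulKmx.
Qed.

(** The left side is the derivative of [invmx S *m P] along the flow. The transformed coefficient
    originates here: [J X J^* - X] collects the derivative of [invmx S] and the correction from
    [inv_mul_A]. *)
Lemma dual_equation (Q : 'M[C]_2) :
  - (invmx S *m (P *m P ^t*) *m invmx S) *m P + invmx S *m (A *m P *m q1 + P *m Q)
  = - (A ^t* *m B *m J) + B *m (Q + J *m X *m J ^t* - X).
Proof.
have -> : invmx S *m (A *m P *m q1 + P *m Q) = (A ^t* *m B + B *m J *m X) *m q1 + B *m Q.
  by rewrite -inv_mul_A mulmxDr /B !mulmxA.
have -> : - (invmx S *m (P *m P ^t*) *m invmx S) *m P = - (B *m X).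
  by rewrite /B /X mulNmx !mulmxA.
rewrite adjJ /q1; move: (B) (X) (A ^t*) => B0 X0 A0.
mx_expand; mx_abel.
Qed.

End Identity.

Lemma q_transformed_antisymmetric (Q X : 'M[C]_2) : J_antisymmetric Q -> X ^t* = X ->
  J_antisymmetric (Q + J *m X *m J ^t* - X).
Proof.
rewrite /J_antisymmetric => QJ XX; rewrite !adjD adjN !adjM XX adjJ adjN adjJ.
have QE : Q *m J = - (J *m Q ^t*) by apply/eqP; rewrite -addr_eq0 QJ.
mx_expand; rewrite QE -[J *m X *m J *m J]mulmxA mulJJ.
by mx_expand; mx_abel.
Qed.

Section Darboux.
Variables (n : nat) (A : 'M[C]_n) (lam : C) (G : 'M[C]_(2, n)) (P : 'M[C]_(n, 2)).
Variables (Q : 'M[C]_2).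
Hypothesis Alam : A - lam%:M \in unitmx.
Let Rs := invmx (A - lam%:M).
Let X := G *m P.
Let Qt := Q + J *m X *m J ^t* - X.
Let w := 1%:M - J *m G *m Rs *m P.
Hypothesis QtJ : J_antisymmetric Qt.

(** The left side is the derivative of [w], with [G] obeying the adjoint of the dual equation. Next
    to the resolvent, [A] equals [(A - lam) + lam], which turns both products into [X + lam W]. *)
Lemma darboux_equation :
  - (J *m (J *m G *m A + Qt ^t* *m G) *m Rs *m P + J *m G *m Rs *m (A *m P *m q1 + P *m Q))
  = lam *: (J *m w - w *m J) - Qt *m w + w *m Q.
Proof.
pose W := G *m Rs *m P.
have AE : A = (A - lam%:M) + lam%:M by rewrite subrK.
have GARP : G *m A *m Rs *m P = X + lam *: W.
  rewrite -[G *m A *m Rs]mulmxA [X in G *m (X *m Rs)]AE mulmxDl mulmxV//.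
  rewrite mul_scalar_mx mulmxDr mulmx1 mulmxDl /X /W.
  by rewrite -scalemxAr -scalemxAl.
have GRAP : G *m Rs *m A *m P = X + lam *: W.
  rewrite -[G *m Rs *m A]mulmxA [X in G *m (Rs *m X)]AE mulmxDr mulVmx//.
  rewrite mul_mx_scalar mulmxDr mulmx1 mulmxDl /X /W.
  by rewrite -scalemxAr -scalemxAl.
have JQ : J *m Qt ^t* = - (Qt *m J) by apply/eqP; rewrite -addr_eq0 addrC QtJ.
have -> : J *m (J *m G *m A + Qt ^t* *m G) *m Rs *m P = - (X + lam *: W) - Qt *m J *m W.
  rewrite -GARP /W; mx_expand; rewrite JQ mulJJ; mx_expand.
  by [].
have -> : J *m G *m Rs *m (A *m P *m q1 + P *m Q) =
    - (J *m (X + lam *: W) *m J) + J *m W *m Q.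
  by rewrite -GRAP /W /q1; mx_expand.
have -> : w = 1%:M - J *m W by rewrite /w /W !mulmxA.
have QE : Q = Qt + X + J *m X *m J.
  by rewrite /Qt adjJ; mx_expand; mx_abel.
move: (Qt) (X) (W) QE => Qt0 X0 W0 QE.
(* Zero enters as [Q - Q] with one copy expressed through [Qt], which makes the rest a purely
   additive identity. *)
rewrite -[RHS]addr0 -(subrr Q) [X in _ = _ + (X - _)]QE.
mx_expand; rewrite mulJJ -?scalemxAr -?scalemxAl; mx_expand.
mx_abel.
Qed.

End Darboux.

(** The inverse is [1 + J P^* E^-1 S^-1 P]: the identity between [D], [E] and [S], multiplied by
    [invmx D] on the left and [invmx E *m invmx S] on the right, makes the cross terms cancel. *)
Lemma woodbury_unit n (D E S : 'M[C]_n) (P : 'M[C]_(n, 2)) :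
  S \in unitmx -> D \in unitmx -> E \in unitmx ->
  D *m S - S *m E = P *m J *m P ^t* ->
  1%:M - J *m P ^t* *m invmx S *m invmx D *m P \in unitmx.
Proof.
move=> Su Du Eu idDE.
have key : invmx D - S *m invmx E *m invmx S
    + invmx D *m (P *m J *m P ^t*) *m invmx E *m invmx S = 0.
  rewrite -idDE; mx_expand; rewrite mulVmx// mul1mx.
  rewrite -[invmx D *m S *m E *m invmx E]mulmxA mulmxV// mulmx1.
  by rewrite -[invmx D *m S *m invmx S]mulmxA mulmxV// mulmx1; mx_abel.
have : J *m P ^t* *m invmx S *m (invmx D - S *m invmx E *m invmx S
    + invmx D *m (P *m J *m P ^t*) *m invmx E *m invmx S) *m P = 0.
  by rewrite key mulmx0 mul0mx.
mx_expand; rewrite -[J *m P ^t* *m invmx S *m S]mulmxA mulVmx// mulmx1 => key2.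
suff /mulmx1_unit[] : (1%:M - J *m P ^t* *m invmx S *m invmx D *m P) *m
  (1%:M + J *m P ^t* *m invmx E *m invmx S *m P) = 1%:M by [].
mx_expand; rewrite -[RHS]subr0 -key2; mx_abel.
Qed.

(** The shift by [lam] cancels in the identity. Both [A] and its adjoint occur, hence both spectra
    are excluded. *)
Lemma darboux_unit n (A S : 'M[C]_n) (P : 'M[C]_(n, 2)) lam :
  S \in unitmx -> A *m S - S *m A ^t* = P *m J *m P ^t* ->
  A - lam%:M \in unitmx -> A ^t* - lam%:M \in unitmx ->
  1%:M - J *m P ^t* *m invmx S *m invmx (A - lam%:M) *m P \in unitmx.
Proof.
move=> Su idS Au Au'; apply: woodbury_unit Su Au Au' _; rewrite -idS; mx_expand.
by rewrite mul_scalar_mx mul_mx_scalar; mx_abel.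
Qed.

End GBDTAlgebra.

(** * The transformed system *)

Section GBDT.
Variable R : realType.
Local Notation C := R[i].
Local Notation J := (@breveJ R).
Local Notation mu := (@lebesgue_measure R).

Lemma ac_ae_derive0 (f : R -> R) a b : a <= b -> abs_continuous a b f ->
  {ae mu, forall x, a < x < b -> is_derive x 1 f 0} -> f a = f b.
Proof.
move=> ab fac fd; apply/eqP; rewrite eq_le; apply/andP; split.
  by apply: (ae_derive_ge0_le ab fac); apply: lebesgue_aeS fd => x H /H; exists 0.
rewrite -lerN2; apply: (ae_derive_ge0_le ab (acN fac)).
apply: lebesgue_aeS fd => x H /H fx; exists 0 => //.
by rewrite -oppr0; exact: is_deriveN.
Qed.

Lemma mx_ac_ae_derive0 p q (F : R -> 'M[C]_(p, q)) a b : a <= b -> mx_ac a b F ->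
  {ae mu, forall x, a < x < b -> mx_is_derive F x 0} -> F a = F b.
Proof.
move=> ab Fac Fd; apply/matrixP => i j; have [fr fi] := Fac i j.
apply/eqP; rewrite eq_complex; apply/andP; split; apply/eqP.
  apply: (ac_ae_derive0 ab fr); apply: lebesgue_aeS Fd => x H /H Fx.
  by have [+ _] := Fx i j; rewrite mxE.
apply: (ac_ae_derive0 ab fi); apply: lebesgue_aeS Fd => x H /H Fx.
by have [_ +] := Fx i j; rewrite mxE.
Qed.

Lemma eq_mx_derive p q (F G : R -> 'M[C]_(p, q)) x D :
  (\near x, F x = G x) -> mx_is_derive F x D -> mx_is_derive G x D.
Proof.
move=> FG FD i j; apply: eq_cx_derive (FD i j).
by apply: filterS FG => y ->.
Qed.

Lemma near_itv (a b x : R) (P : R -> Prop) : a < x < b ->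
  (forall y, a < y < b -> P y) -> \near x, P x.
Proof.
move=> xab H; have /near_in_itvoo : x \in `]a, b[ by rewrite in_itv.
by apply: filterS => y; rewrite in_itv; exact: H.
Qed.

Lemma posdef_herm n (M : 'M[C]_n) : posdef M -> M ^t* = M.
Proof. by move=> [/is_hermitianmxP H _]; rewrite [RHS]H expr0 scale1r. Qed.

Lemma positive_unit n (M : 'M[C]_n) :
  (forall v : 'rV[C]_n, v != 0 -> 0 < (v *m M *m v ^t*) 0 0) -> M \in unitmx.
Proof.
move=> Mpos; rewrite -row_free_unit -kermx_eq0; apply/negPn/negP => K0.
have v0 : nz_row (kermx M) != 0 by rewrite nz_row_eq0.
have := Mpos _ v0; have /sub_kermxP -> := nz_row_sub (kermx M).
by rewrite mul0mx mxE ltxx.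
Qed.

Lemma posdef_unit n (M : 'M[C]_n) : posdef M -> M \in unitmx.
Proof. by case=> _; exact: positive_unit. Qed.

Lemma not_eigenvalue_unit n (A : 'M[C]_n) lam : ~~ eigenvalue A lam -> A - lam%:M \in unitmx.
Proof. by rewrite /eigenvalue /eigenspace negbK kermx_eq0 row_free_unit. Qed.

(** The data that survive deletion of the last row. [S] is positive only for [x > 0]; at zero the
    identity alone is kept. *)
Definition gbdt l (Q : R -> 'M[C]_2) n (A : 'M[C]_n) (Pi : R -> 'M[C]_(n, 2))
    (S : R -> 'M[C]_n) :=
  [/\ ac_derivative `[0, l[%classic Pi (fun x => A *m Pi x *m q1 + Pi x *m Q x),
      ac_derivative `[0, l[%classic S (fun x => Pi x *m (Pi x) ^t*),
      forall x, 0 < x < l -> posdef (S x) &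
      A *m S 0 - S 0 *m A ^t* = Pi 0 *m J *m (Pi 0) ^t*].

Variables (l : R) (Q : R -> 'M[C]_2).
Hypothesis QJ : forall x, J_antisymmetric (Q x).

Section Solution.
Variables (n : nat) (A : 'M[C]_n) (Pi : R -> 'M[C]_(n, 2)) (S : R -> 'M[C]_n).
Hypothesis AB : gbdt l Q A Pi S.

Lemma gbdt_Pi_ac a b : 0 <= a -> a <= b -> b < l -> mx_ac a b Pi.
Proof.
have [[Pac _] _ _ _] := AB => a0 ab bl i j; apply: Pac => // x /=.
by rewrite !in_itv/= => /andP[ax xb]; rewrite (le_trans a0)//= (le_lt_trans xb).
Qed.

Lemma gbdt_S_ac a b : 0 <= a -> a <= b -> b < l -> mx_ac a b S.
Proof.
have [_ [Sac _] _ _] := AB => a0 ab bl i j; apply: Sac => // x /=.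
by rewrite !in_itv/= => /andP[ax xb]; rewrite (le_trans a0)//= (le_lt_trans xb).
Qed.

Lemma gbdt_derive : {ae mu, forall x, 0 < x < l ->
  mx_is_derive Pi x (A *m Pi x *m q1 + Pi x *m Q x) /\
  mx_is_derive S x (Pi x *m (Pi x) ^t*)}.
Proof.
have [[_ Pd] [_ Sd] _ _] := AB; apply: lebesgue_aeS2 Pd Sd => x Px Sx /andP[x0 xl].
by split; [apply: Px|apply: Sx]; rewrite /= in_itv/= (ltW x0).
Qed.

(** The defect has derivative zero almost everywhere: the terms in [Q] cancel by [QJ], those in [A]
    because [J *m J = - 1]. *)
Lemma gbdt_identity x : 0 <= x < l -> A *m S x - S x *m A ^t* = Pi x *m J *m (Pi x) ^t*.
Proof.
move=> /andP[x0 xl]; have [_ _ _ id0] := AB.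
have Pac := gbdt_Pi_ac (lexx 0) x0 xl; have Sac := gbdt_S_ac (lexx 0) x0 xl.
pose F y := A *m S y - S y *m A ^t* - Pi y *m J *m (Pi y) ^t*.
suff : F 0 = F x by rewrite /F id0 subrr => /esym/eqP; rewrite subr_eq0 => /eqP.
apply: mx_ac_ae_derive0 => //.
  apply: mx_acB; last by apply: mx_acM (mx_ac_adj Pac); apply: mx_acM => //; exact: mx_ac_cst.
  by apply: mx_acB; apply: mx_acM => //; exact: mx_ac_cst.
apply: lebesgue_aeS gbdt_derive => y H /andP[y0 yx].
have [|Pd Sd] := H; first by rewrite y0 (lt_trans yx).
have := mx_deriveB (mx_deriveB (mx_deriveM (mx_derive_cst A y) Sd)
  (mx_deriveM Sd (mx_derive_cst (A ^t*) y)))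
  (mx_deriveM (mx_deriveM Pd (mx_derive_cst J y)) (mx_derive_adj Pd)).
congr mx_is_derive.
have QE : Q y *m J = - (J *m (Q y) ^t*) by apply/eqP; rewrite -addr_eq0 QJ.
rewrite /q1 adjD !adjM adjN adjJ opprK; mx_expand; rewrite -[_ *m Q y *m J]mulmxA QE.
rewrite -[A *m _ *m J *m J]mulmxA -[Pi y *m J *m J]mulmxA mulJJ; mx_expand.
by rewrite !addr0 ?add0r; mx_abel.
Qed.

Let X := Xmx Pi S.
Let Qt := q0_transformed Q Pi S.

Lemma gbdt_unit x : 0 < x < l -> S x \in unitmx.
Proof. by have [_ _ Spos _] := AB => /Spos/posdef_unit. Qed.

Lemma gbdt_herm x : 0 < x < l -> (S x) ^t* = S x.
Proof. by have [_ _ Spos _] := AB => /Spos/posdef_herm. Qed.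

Lemma adj_invmx (M : 'M[C]_n) : (invmx M) ^t* = invmx (M ^t*).
Proof. by rewrite trmx_inv map_invmx. Qed.

Lemma X_herm x : 0 < x < l -> (X x) ^t* = X x.
Proof. by move=> xl; rewrite /X /Xmx !adjM trmxCK adj_invmx gbdt_herm// mulmxA. Qed.

Lemma Qt_J x : 0 < x < l -> J_antisymmetric (Qt x).
Proof. by move=> xl; apply: q_transformed_antisymmetric => //; exact: X_herm. Qed.

Lemma gbdt_inv_Pi_derive x : 0 < x < l ->
  mx_is_derive Pi x (A *m Pi x *m q1 + Pi x *m Q x) ->
  mx_is_derive S x (Pi x *m (Pi x) ^t*) ->
  mx_is_derive (fun y => invmx (S y) *m Pi y) x
    (- (A ^t* *m (invmx (S x) *m Pi x) *m J) + invmx (S x) *m Pi x *m Qt x).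
Proof.
move=> xl Pd Sd; have /andP[x0 xl'] := xl.
have Su : \near x, S x \in unitmx by apply: near_itv xl _ => y; exact: gbdt_unit.
have idS : A *m S x - S x *m A ^t* = Pi x *m J *m (Pi x) ^t*.
  by apply: gbdt_identity; rewrite (ltW x0).
have := mx_deriveM (mx_derive_inv Sd Su) Pd.
by rewrite (dual_equation (gbdt_unit xl) idS).
Qed.

Lemma wA_derive lam x : A - lam%:M \in unitmx -> 0 < x < l ->
  mx_is_derive Pi x (A *m Pi x *m q1 + Pi x *m Q x) ->
  mx_is_derive S x (Pi x *m (Pi x) ^t*) ->
  let w y := wA A Pi S y lam in
  mx_is_derive w x (lam *: (J *m w x - w x *m J) - Qt x *m w x + w x *m Q x).
Proof.
move=> Alam xl Pd Sd w.
(* As an adjoint, [G] inherits its derivative from the dual equation; it agrees with the factor in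
   [wA] wherever [S] is Hermitian. *)
pose G y := (invmx (S y) *m Pi y) ^t*.
have GE y : 0 < y < l -> G y = (Pi y) ^t* *m invmx (S y).
  by move=> yl; rewrite /G adjM adj_invmx gbdt_herm.
pose v y := 1%:M - J *m G y *m invmx (A - lam%:M) *m Pi y.
have vw y : 0 < y < l -> v y = w y by move=> yl; rewrite /w /wA -[J *m _ *m invmx (S y)]mulmxA -GE.
apply: (@eq_mx_derive _ _ v); first exact: near_itv xl vw.
have Gd := mx_derive_adj (gbdt_inv_Pi_derive xl Pd Sd).
have := mx_deriveB (mx_derive_cst 1%:M x)
  (mx_deriveM (mx_deriveM (mx_deriveM (mx_derive_cst J x) Gd) (mx_derive_cst (invmx (A - lam%:M)) x)) Pd).
rewrite -vw//; congr mx_is_derive.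
have QtJ := Qt_J xl.
have XE : Xmx Pi S x = G x *m Pi x by rewrite GE.
have QtE : Qt x = Q x + J *m (G x *m Pi x) *m J ^t* - G x *m Pi x.
  by rewrite -XE.
rewrite QtE in QtJ *.
rewrite /v -(darboux_equation Alam QtJ).
have HE (V : 'M[C]_2) (B0 : 'M[C]_(n, 2)) : (- (A ^t* *m B0 *m J) + B0 *m V) ^t* =
    J *m B0 ^t* *m A + V ^t* *m B0 ^t*.
  by rewrite adjD adjN !adjM trmxCK adjJ mulNmx opprK mulmxA.
by rewrite HE mul0mx mulmx0 !add0r !addr0.
Qed.

Lemma darboux_fundamental lam u : not_in_spectra A lam ->
  is_fundamental_solution l Q lam u ->
  is_fundamental_solution l Qt lam (fun x => wA A Pi S x lam *m u x).
Proof.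
move=> [/not_eigenvalue_unit Au /not_eigenvalue_unit Au'] [[uac ueq] uu].
split; [split|].
- move=> a b ab abl.
  have [a0 bl] : 0 < a /\ b < l.
    have := abl a; have := abl b; rewrite /= !in_itv/= !lexx ab.
    by move=> /(_ isT)/andP[_ ->] /(_ isT)/andP[-> _].
  have Pac := gbdt_Pi_ac (ltW a0) ab bl; have Sac := gbdt_S_ac (ltW a0) ab bl.
  have uab : mx_ac a b u by exact: uac.
  have SVac : mx_ac a b (fun y => invmx (S y)).
    apply: mx_ac_inv => // x /andP[ax xb]; apply: gbdt_unit.
    by rewrite (lt_le_trans a0)// (le_lt_trans xb).
  suff : mx_ac a b (fun x => wA A Pi S x lam *m u x) by [].
  apply: mx_acM => //; apply: mx_acB; first exact: mx_ac_cst.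
  apply: mx_acM => //; apply: mx_acM; last exact: mx_ac_cst.
  by apply: mx_acM => //; apply: mx_acM; [exact: mx_ac_cst|exact: mx_ac_adj].
- apply: lebesgue_aeS2 ueq gbdt_derive => x Hu HD xl.
  have [ux ud uE] := Hu xl; have [Pd Sd] := HD xl.
  have wd := wA_derive Au xl Pd Sd.
  eexists; first exact: mx_deriveM wd ud.
  have -> : ux = - ((lam *: q1 + Q x) *m u x).
    by apply/eqP; rewrite -addr_eq0 uE.
  move: (wA A Pi S x lam) (Qt x) => w qt; rewrite /q1.
  rewrite -?scalemxAl -?scalemxAr; mx_expand.
  rewrite -?scalemxAl -?scalemxAr; mx_expand; rewrite ?scalerN ?mulNmx ?mulmxN.
  by rewrite -?scalemxAl -?scalemxAr; mx_expand; mx_abel.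
- move=> x xl; rewrite unitmx_mul uu// andbT.
  have /andP[x0 xl'] := xl.
  apply: darboux_unit => //; first exact: gbdt_unit.
  by apply: gbdt_identity; rewrite (ltW x0).
Qed.

End Solution.
End GBDT.

(** * Elimination of the last row *)

Section SchurStep.
Variable R : realType.
Local Notation C := R[i].
Local Notation J := (@breveJ R).
Local Notation mu := (@lebesgue_measure R).

Lemma adj_block p1 p2 q1 q2 (A : 'M[C]_(p1, q1)) B D (E : 'M[C]_(p2, q2)) :
  (block_mx A B D E) ^t* = block_mx (A ^t*) (D ^t*) (B ^t*) (E ^t*).
Proof. by rewrite tr_block_mx map_block_mx. Qed.

Lemma adj_col p1 p2 q (A : 'M[C]_(p1, q)) (B : 'M[C]_(p2, q)) :
  (col_mx A B) ^t* = row_mx (A ^t*) (B ^t*).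
Proof. by rewrite tr_col_mx map_row_mx. Qed.

Lemma adj_row p q1 q2 (A : 'M[C]_(p, q1)) (B : 'M[C]_(p, q2)) :
  (row_mx A B) ^t* = col_mx (A ^t*) (B ^t*).
Proof. by rewrite tr_row_mx map_col_mx. Qed.

Lemma adj0 p q : (0 : 'M[C]_(p, q)) ^t* = 0.
Proof. by rewrite trmx0 map_mx0. Qed.

Lemma adj1 p : (1%:M : 'M[C]_p) ^t* = 1%:M.
Proof. by rewrite trmx1 map_mx1. Qed.

Section Schur.
Variables (n : nat) (S : 'M[C]_n) (s : 'rV[C]_n) (g : 'M[C]_1) (P : 'M[C]_(n, 2)) (p : 'M[C]_(1, 2)).
Hypothesis Spos : posdef (block_mx S (s ^t*) s g).
Let h := p - s *m (invmx S *m P).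
Let tau := g - s *m invmx S *m s ^t*.

Lemma posdef_ul : posdef S.
Proof.
have Sh := posdef_herm Spos; have [_ Sp] := Spos; split.
  apply/is_hermitianmxP; rewrite expr0 scale1r.
  by move: Sh; rewrite adj_block => /eq_block_mx[].
move=> v v0; have := Sp (row_mx v 0).
rewrite row_mx_eq0 negb_and v0 => /(_ isT).
by rewrite mul_row_block adj_row mul_row_col !mul0mx !addr0 adj0 mulmx0 addr0.
Qed.

Let Su : S \in unitmx. Proof. exact: posdef_unit posdef_ul. Qed.
Let SVh : (invmx S) ^t* = invmx S.
Proof. by rewrite adj_invmx (posdef_herm posdef_ul). Qed.

(** The Schur complement is the value of the quadratic form at the row vector [(- s S^-1, 1)]. *)
Lemma schur_gt0 : 0 < tau 0 0.
Proof.
have [_ Sp] := Spos; have := Sp (row_mx (- (s *m invmx S)) 1%:M).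
rewrite row_mx_eq0 negb_and orbC.
have -> : (1%:M : 'M[C]_1) != 0 by apply/eqP => /matrixP/(_ 0 0)/eqP; rewrite !mxE oner_eq0.
move=> /(_ isT); rewrite mul_row_block adj_row mul_row_col !mul1mx !mulNmx.
by rewrite -[s *m invmx S *m S]mulmxA mulVmx// mulmx1 addNr mul0mx add0r adj1 mulmx1 addrC.
Qed.

Lemma schur_le : tau 0 0 <= g 0 0.
Proof.
rewrite -subr_ge0; have -> : g 0 0 - tau 0 0 = (s *m invmx S *m s ^t*) 0 0.
  by rewrite /tau !mxE; ring.
have [_ Sp] := posdef_ul.
have -> : s *m invmx S *m s ^t* = s *m invmx S *m S *m (s *m invmx S) ^t*.
  by rewrite adjM SVh mulmxA -[s *m invmx S *m S]mulmxA mulVmx// mulmx1.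
have [->|w0] := eqVneq (s *m invmx S) 0; first by rewrite !mul0mx mxE.
exact/ltW/Sp.
Qed.

Lemma schur_unit : tau \in unitmx.
Proof. by rewrite unitmxE unitfE det_mx11 gt_eqF// schur_gt0. Qed.

(* [S Y = Pi] with [Y] obtained by block elimination. *)
Lemma schur_X :
  (col_mx P p) ^t* *m invmx (block_mx S (s ^t*) s g) *m col_mx P p
  = P ^t* *m invmx S *m P + h ^t* *m invmx tau *m h.
Proof.
pose t := invmx tau.
pose Y := col_mx (invmx S *m P - invmx S *m s ^t* *m t *m h) (t *m h).
have SY : block_mx S (s ^t*) s g *m Y = col_mx P p.
  rewrite mul_block_col; congr col_mx.
    rewrite mulmxBr !mulmxA mulmxV// !mul1mx -!mulmxA; exact: subrK.
  have -> : g = tau + s *m invmx S *m s ^t* by rewrite /tau subrK.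
  rewrite mulmxDl [tau *m _]mulmxA /t mulmxV ?schur_unit// mul1mx.
  by rewrite /h; mx_expand; mx_abel.
rewrite -{2}SY [_ *m invmx _ *m _]mulmxA mulmxKV; last exact: posdef_unit.
have hE : h ^t* = p ^t* - P ^t* *m invmx S *m s ^t*.
  by rewrite /h adjB !adjM SVh.
rewrite adj_col mul_row_col hE -/t.
move: (h) (t) (invmx S) (s ^t*) (p ^t*) (P ^t*) => h0 t0 SV sa pa Pa.
by mx_expand; mx_abel.
Qed.

(** The left side is the derivative of [h]. The last row of the operator identity eliminates
    [s *m A ^t*]; the terms in [al] then cancel, so [h] obeys a closed equation with the scalar
    [a]. *)
Lemma schur_h_derive (Q X : 'M[C]_2) (A : 'M[C]_n) (al : 'rV[C]_n) (a : 'M[C]_1) :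
  al *m S + a *m s - s *m A ^t* = p *m J *m P ^t* ->
  X = P ^t* *m invmx S *m P ->
  (al *m P + a *m p) *m q1 + p *m Q
  - (p *m P ^t* *m (invmx S *m P) + s *m (- (A ^t* *m (invmx S *m P) *m J) +
       invmx S *m P *m (Q + J *m X *m J ^t* - X)))
  = - (a *m h *m J) + h *m (Q + J *m X *m J ^t* - X).
Proof.
move=> idS XE; set B := invmx S *m P.
have sAB : s *m A ^t* *m B = al *m P + a *m s *m B - p *m J *m X.
  have -> : s *m A ^t* = al *m S + a *m s - p *m J *m P ^t* by rewrite -idS; mx_abel.
  rewrite mulmxBl mulmxDl -[al *m S *m B]mulmxA /B mulKVmx// XE !mulmxA.
  by rewrite ?mulmxA.
have PB : P ^t* *m B = X by rewrite XE /B !mulmxA.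
rewrite /h -/B; move: B sAB PB => B sAB PB; rewrite adjJ /q1.
mx_expand; rewrite sAB -[p *m P ^t* *m B]mulmxA PB.
by mx_expand; mx_abel.
Qed.

(** The left side is the derivative of [tau]; completing the square in [p] and [s S^-1 P] gives the
    right side. *)
Lemma schur_tau_derive :
  p *m p ^t* - (p *m P ^t* *m invmx S *m s ^t*
    + s *m (- (invmx S *m (P *m P ^t*) *m invmx S)) *m s ^t*
    + s *m invmx S *m (P *m p ^t*)) = h *m h ^t*.
Proof.
rewrite /h adjB !adjM SVh; mx_expand; mx_abel.
Qed.

End Schur.
End SchurStep.

(** * Boundedness and limits at zero *)

Section BoundedNearZero.
Variable R : realType.
Local Notation C := R[i].
Local Notation Re := (@complex.Re R).
Local Notation Im := (@complex.Im R).
Implicit Types (f g : R -> C) (x : R).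

Definition bdd0 f := exists M, \forall x \near 0^'+, `|Re (f x)| <= M /\ `|Im (f x)| <= M.

Lemma near_right0P (P : R -> Prop) :
  (\forall x \near 0^'+, P x) <-> exists2 e, 0 < e & forall x, 0 < x < e -> P x.
Proof.
split => [[e /= e0 H]|[e e0 H]].
  exists e => // x /andP[x0 xe]; apply: H => //=.
  by rewrite sub0r normrN gtr0_norm.
exists e => //= x /=; rewrite sub0r normrN => xe x0; apply: H.
by rewrite x0 -(gtr0_norm x0).
Qed.

Lemma normc_bound (z : C) (M : R) : `|Re z| <= M -> `|Im z| <= M -> `|z| <= (M + M)%:C.
Proof.
case: z => a b /= aM bM; have M0 := le_trans (normr_ge0 _) aM.
rewrite normc_def lecR /=; apply: (le_trans (y := Num.sqrt ((`|a| + `|b|) ^+ 2))).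
  rewrite ler_sqrt ?sqr_ge0// sqrrD !real_normK ?num_real//.
  by have : 0 <= `|a| * `|b| by []; rewrite mulr2n; lra.
by rewrite sqrtr_sqr ger0_norm ?addr_ge0// lerD.
Qed.

Lemma norm_ReIm (z : C) (M : R) : `|z| <= M%:C -> `|Re z| <= M /\ `|Im z| <= M.
Proof.
case: z => x y; rewrite normc_def lecR /= => zM; split; apply: le_trans zM.
  by rewrite -sqrtr_sqr ler_sqrt ?addr_ge0 ?sqr_ge0// lerDl sqr_ge0.
by rewrite -sqrtr_sqr ler_sqrt ?addr_ge0 ?sqr_ge0// lerDr sqr_ge0.
Qed.

Lemma bounded_near_zeroP p q (F : R -> 'M[C]_(p, q)) :
  bounded_near_zero F <-> forall i j, bdd0 (fun x => F x i j).
Proof.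
split => [[e e0 [M H]] i j|H].
  exists M; apply/near_right0P; exists e => // x /H /(_ i j).
  exact: norm_ReIm.
have /choice[M HM] : forall t : 'I_p * 'I_q, exists M, \forall x \near 0^'+,
    `|Re (F x t.1 t.2)| <= M /\ `|Im (F x t.1 t.2)| <= M by move=> t; exact: H.
have : \forall x \near 0^'+, forall t : 'I_p * 'I_q,
    `|Re (F x t.1 t.2)| <= M t /\ `|Im (F x t.1 t.2)| <= M t by exact: filter_forall.
move=> /near_right0P[e e0 HF].
exists e => //; exists (\sum_t (`|M t| + `|M t|)) => x xe i j.
have [h1 h2] := HF _ xe (i, j); apply: (le_trans (normc_bound h1 h2)).
rewrite lecR (bigD1 (i, j))//= -[X in X <= _]addr0; apply: lerD.
  by rewrite lerD// ler_norm.
by apply: sumr_ge0 => t _; rewrite addr_ge0.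
Qed.

Lemma bdd0_cst z : bdd0 (fun=> z).
Proof.
exists (`|Re z| + `|Im z|); apply: nearW => x.
by rewrite lerDl lerDr !normr_ge0.
Qed.

Lemma bdd0D f g : bdd0 f -> bdd0 g -> bdd0 (fun x => f x + g x).
Proof.
move=> [M HM] [N HN]; exists (M + N); apply: filterS2 HM HN => x [h1 h2] [h3 h4].
by rewrite cxReD cxImD; split; apply: (le_trans (ler_normD _ _)); rewrite lerD.
Qed.

Lemma bdd0N f : bdd0 f -> bdd0 (fun x => - f x).
Proof.
move=> [M HM]; exists M; apply: filterS HM => x.
by rewrite cxReN cxImN !normrN.
Qed.

Lemma bdd0B f g : bdd0 f -> bdd0 g -> bdd0 (fun x => f x - g x).
Proof. by move=> fb /bdd0N gb; exact: bdd0D. Qed.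

Lemma eq_bdd0 f g : (\forall x \near 0^'+, f x = g x) -> bdd0 f -> bdd0 g.
Proof. by move=> fg [M HM]; exists M; apply: filterS2 fg HM => x ->. Qed.

Lemma cx_ac_bdd0 b f : 0 < b -> cx_ac 0 b f -> bdd0 f.
Proof.
move=> b0 [/ac_bounded[M HM] /ac_bounded[N HN]]; exists (`|M| + `|N|).
apply/near_right0P; exists b => // x /andP[/ltW x0 /ltW xb].
have xb' : 0 <= x <= b by rewrite x0.
split; [apply: (le_trans (HM _ xb'))|apply: (le_trans (HN _ xb'))].
  by rewrite (le_trans (ler_norm _))// lerDl.
by rewrite (le_trans (ler_norm _))// lerDr.
Qed.

Lemma ac_tends_to0 b (f : R -> R) : 0 < b -> abs_continuous 0 b f ->
  tends_to0 (fun x => f x - f 0).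
Proof.
move=> b0 fac eps eps0; have [d d0 H] := ac_uniform fac eps0.
exists (Num.min d b) => [|x /andP[x0]]; first by rewrite lt_min d0.
rewrite lt_min => /andP[xd xb]; apply: H; rewrite ?lexx ?ltW ?x0 ?xb//.
by rewrite subr0 gtr0_norm.
Qed.

End BoundedNearZero.

(** * The leading blocks and the equations of the last row *)

Section LastRow.
Variable R : realType.
Local Notation C := R[i].
Local Notation J := (@breveJ R).
Local Notation mu := (@lebesgue_measure R).

(** Every block is a reindexing of the full matrix, so one statement covers them all. *)
Lemma mx_derive_reindex p q p' q' (F : R -> 'M[C]_(p, q)) (F' : R -> 'M[C]_(p', q'))
    (f : 'I_p' -> 'I_p) (g : 'I_q' -> 'I_q) x (D : 'M[C]_(p, q)) (D' : 'M[C]_(p', q')) :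
  (forall y i j, F' y i j = F y (f i) (g j)) ->
  (forall i j, D' i j = D (f i) (g j)) ->
  mx_is_derive F x D -> mx_is_derive F' x D'.
Proof.
move=> FF DD FD i j; apply: cx_derive_ext (FD (f i) (g j)) _ _ => [y|].
  by rewrite FF.
by rewrite DD.
Qed.

Lemma ac_derivative_reindex p q p' q' I (F G : R -> 'M[C]_(p, q)) (F' G' : R -> 'M[C]_(p', q'))
    (f : 'I_p' -> 'I_p) (g : 'I_q' -> 'I_q) :
  (forall y i j, F' y i j = F y (f i) (g j)) ->
  (forall y i j, G' y i j = G y (f i) (g j)) ->
  ac_derivative I F G -> ac_derivative I F' G'.
Proof.
move=> FF GG [Fac FD]; split.
  move=> a b ab abI i j; have [fr fi] := Fac a b ab abI (f i) (g j).
  by split; [apply: eq_ac fr|apply: eq_ac fi] => y _; rewrite /= FF.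
apply: lebesgue_aeS FD => x H /H; exact: mx_derive_reindex.
Qed.

Variables (l : R) (Q : R -> 'M[C]_2).
Hypothesis QJ : forall x, J_antisymmetric (Q x).
Variables (n : nat) (A : 'M[C]_(n + 1)) (Pi : R -> 'M[C]_(n + 1, 2)) (S : R -> 'M[C]_(n + 1)).
Hypothesis AB : gbdt l Q A Pi S.
Hypothesis A_lower : ursubmx A = 0.

Let Ar := ulsubmx A.
Let al := dlsubmx A.
Let a := drsubmx A.
Definition lead_Pi y := usubmx (Pi y).
Definition lead_S y := ulsubmx (S y).
Let Pr := lead_Pi.
Let pr y := dsubmx (Pi y).
Let Sr := lead_S.
Definition last_S y := dlsubmx (S y).
Let sr := last_S.
Definition corner_S y := drsubmx (S y).
Let gr := corner_S.

Let AE : A = block_mx Ar 0 al a. Proof. by rewrite -A_lower submxK. Qed.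
Let PiE y : Pi y = col_mx (Pr y) (pr y). Proof. by rewrite vsubmxK. Qed.

Let SE y : 0 < y < l -> S y = block_mx (Sr y) ((sr y) ^t*) (sr y) (gr y).
Proof.
move=> yl; rewrite -[LHS]submxK; congr block_mx.
have := gbdt_herm AB yl; rewrite -{1 2}[S y]submxK adj_block => /eq_block_mx[_ + _ _].
by move=> ->.
Qed.

(** The vanishing upper right block of [A] makes the equation for the leading rows of [Pi]
    closed. *)
Lemma lead_gbdt : gbdt l Q Ar Pr Sr.
Proof.
have [Pd Sd Spos id0] := AB; split.
- apply: (ac_derivative_reindex (f := lshift 1) (g := id) _ _ Pd) => y i j; first by rewrite mxE.
  rewrite AE PiE mul_block_col mul_col_mx mul_col_mx add_col_mx col_mxEu.
  by rewrite mul0mx addr0.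
- apply: (ac_derivative_reindex (f := lshift 1) (g := lshift 1) _ _ Sd) => y i j; first by rewrite !mxE.
  by rewrite PiE adj_col mul_col_row block_mxEul.
- by move=> y yl; have := Spos _ yl; rewrite SE// => /posdef_ul.
- move: id0; rewrite AE PiE -{1 2}[S 0]submxK adj_block adj_col !mulmx_block mul_col_mx mul_col_row.
  rewrite opp_block_mx add_block_mx => /eq_block_mx[+ _ _ _].
  by rewrite adj0 mul0mx mulmx0 !addr0.
Qed.

Definition last_h y := pr y - sr y *m (invmx (Sr y) *m Pr y).
Definition last_tau y := gr y - sr y *m invmx (Sr y) *m (sr y) ^t*.
Let h := last_h.
Let tau := last_tau.
Let Qt := q0_transformed Q Pr Sr.

Let pos y : 0 < y < l -> posdef (block_mx (Sr y) ((sr y) ^t*) (sr y) (gr y)).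
Proof. by have [_ _ Spos _] := AB => yl; rewrite -SE//; exact: Spos. Qed.

Lemma last_X y : 0 < y < l ->
  Xmx Pi S y = Xmx Pr Sr y + (h y) ^t* *m invmx (tau y) *m h y.
Proof. by move=> yl; rewrite /Xmx SE// PiE schur_X//; exact: pos. Qed.

Lemma last_tau_gt0 y : 0 < y < l -> 0 < tau y 0 0.
Proof. by move=> /pos; exact: schur_gt0. Qed.

Lemma last_tau_le y : 0 < y < l -> tau y 0 0 <= gr y 0 0.
Proof. by move=> /pos; exact: schur_le. Qed.

Let last_id y : 0 < y < l ->
  al *m Sr y + a *m sr y - sr y *m Ar ^t* = pr y *m J *m (Pr y) ^t*.
Proof.
move=> yl; have /andP[y0 yl'] := yl.
have : A *m S y - S y *m A ^t* = Pi y *m J *m (Pi y) ^t*.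
  by apply: (gbdt_identity QJ AB); rewrite ltW.
rewrite AE PiE SE// adj_block adj_col !mulmx_block mul_col_mx mul_col_row.
rewrite opp_block_mx add_block_mx => /eq_block_mx[_ _ + _].
by rewrite adj0 mulmx0 addr0.
Qed.

Lemma last_derive : {ae mu, forall x, 0 < x < l ->
  mx_is_derive h x (- (a *m h x *m J) + h x *m Qt x) /\
  mx_is_derive tau x (h x *m (h x) ^t*)}.
Proof.
apply: lebesgue_aeS (gbdt_derive AB) => x H xl; have [Pd Sd] := H xl.
have Prd : mx_is_derive Pr x (Ar *m Pr x *m q1 + Pr x *m Q x).
  apply: (mx_derive_reindex (f := lshift 1) (g := id) _ _ Pd) => [y i j|i j].
    by rewrite mxE.
  rewrite AE PiE mul_block_col mul_col_mx mul_col_mx add_col_mx col_mxEu.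
  by rewrite mul0mx addr0.
have prd : mx_is_derive pr x ((al *m Pr x + a *m pr x) *m q1 + pr x *m Q x).
  apply: (mx_derive_reindex (f := @rshift n 1) (g := id) _ _ Pd) => [y i j|i j].
    by rewrite mxE.
  by rewrite AE PiE mul_block_col mul_col_mx mul_col_mx add_col_mx col_mxEd.
have Srd : mx_is_derive Sr x (Pr x *m (Pr x) ^t*).
  apply: (mx_derive_reindex (f := lshift 1) (g := lshift 1) _ _ Sd) => [y i j|i j].
    by rewrite !mxE.
  by rewrite PiE adj_col mul_col_row block_mxEul.
have srd : mx_is_derive sr x (pr x *m (Pr x) ^t*).
  apply: (mx_derive_reindex (f := @rshift n 1) (g := lshift 1) _ _ Sd) => [y i j|i j].
    by rewrite !mxE.
  by rewrite PiE adj_col mul_col_row block_mxEdl.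
have grd : mx_is_derive gr x (pr x *m (pr x) ^t*).
  apply: (mx_derive_reindex (f := @rshift n 1) (g := @rshift n 1) _ _ Sd) => [y i j|i j].
    by rewrite !mxE.
  by rewrite PiE adj_col mul_col_row block_mxEdr.
have Bd := gbdt_inv_Pi_derive QJ lead_gbdt xl Prd Srd.
split.
  have := mx_deriveB prd (mx_deriveM srd Bd).
  by rewrite (schur_h_derive (pos xl) (Q x) (last_id xl) erefl).
have Su : \near x, Sr x \in unitmx.
  by apply: near_itv xl _ => y yl; apply: posdef_unit; have [_ _ + _] := lead_gbdt; apply.
have := mx_deriveB grd (mx_deriveM (mx_deriveM srd (mx_derive_inv Srd Su)) (mx_derive_adj srd)).
congr mx_is_derive; rewrite adjM trmxCK mulmxDl.
exact: schur_tau_derive (pos xl).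
Qed.

Let sub_ac b1 b2 : 0 <= b1 -> b1 <= b2 -> b2 < l ->
  [/\ mx_ac b1 b2 Pr, mx_ac b1 b2 pr, mx_ac b1 b2 Sr, mx_ac b1 b2 sr & mx_ac b1 b2 gr].
Proof.
move=> b10 b12 b2l; have Pac := gbdt_Pi_ac AB b10 b12 b2l.
have Sac := gbdt_S_ac AB b10 b12 b2l.
split=> i j.
- by apply: eq_cx_ac (Pac (lshift 1 i) j) => y _; rewrite !mxE.
- by apply: eq_cx_ac (Pac (rshift n i) j) => y _; rewrite !mxE.
- by apply: eq_cx_ac (Sac (lshift 1 i) (lshift 1 j)) => y _; rewrite !mxE.
- by apply: eq_cx_ac (Sac (rshift n i) (lshift 1 j)) => y _; rewrite !mxE.
- by apply: eq_cx_ac (Sac (rshift n i) (rshift n j)) => y _; rewrite !mxE.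
Qed.

(** The left end may be zero provided the leading block is invertible there, as it is for the first
    adjoined row. *)
Lemma last_ac b1 b2 : 0 <= b1 -> b1 <= b2 -> b2 < l ->
  (forall x, b1 <= x <= b2 -> Sr x \in unitmx) -> mx_ac b1 b2 h /\ mx_ac b1 b2 tau.
Proof.
move=> b10 b12 b2l Su; have [Pac pac Sac sac gac] := sub_ac b10 b12 b2l.
have SVac := mx_ac_inv b12 Sac Su; split; apply: mx_acB => //.
  by apply: mx_acM => //; exact: mx_acM.
by apply: mx_acM (mx_ac_adj sac); exact: mx_acM.
Qed.

Lemma corner_ac b2 : 0 <= b2 -> b2 < l -> mx_ac 0 b2 gr.
Proof. by move=> b20 b2l; have [_ _ _ _] := sub_ac (lexx 0) b20 b2l. Qed.

End LastRow.

(** * The rank-one step *)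

Section RankOneStep.
Variable R : realType.
Local Notation C := R[i].
Local Notation Re := (@complex.Re R).
Local Notation Im := (@complex.Im R).
Local Notation J := (@breveJ R).
Local Notation mu := (@lebesgue_measure R).

(* [b] records which component of [h] behaves like [x ^ k]: the first one exactly
   when [b] holds, and then the coefficient of [sigma3 / x] is [k], else [- k]. *)
Definition component (b : bool) : 'I_2 := if b then 0 else 1.
Definition signed_nat (b : bool) (k : nat) : int := if b then k%:Z else - k%:Z.
Arguments signed_nat b k%_nat_scope.
Definition sign_of (b : bool) : R := if b then 1 else -1.

Lemma sum_component (V : nmodType) b (F : 'I_2 -> V) : \sum_j F j = F (component b) + F (component (~~ b)).
Proof.
rewrite big_ord_recl big_ord1 /component; case: b; last rewrite addrC;
  by congr (F _ + F _); apply/val_inj.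
Qed.

Lemma ord2P (j : 'I_2) : j = 0 \/ j = 1.
Proof. by case: j => [[|[|//]] i2]; [left|right]; exact/val_inj. Qed.

Lemma component_cases b (P : 'I_2 -> Prop) : P (component b) -> P (component (~~ b)) -> forall j, P j.
Proof.
by move=> P0 P1 j; have [->|->] := ord2P j; case: b P0 P1.
Qed.

Lemma mul_sigma3 (h : 'rV[C]_2) b : (h *m sigma3) 0 (component b) = (sign_of b)%:C * h 0 (component b).
Proof.
rewrite mxE big_ord_recl big_ord1 !mxE; case: b => /=.
  by rewrite mulr1 mulr0 addr0 mul1r.
by rewrite mulr0 add0r mulrN1 rmorphN mulN1r; congr (- h _ _); apply/val_inj.
Qed.

Lemma signed_natC b k x : (signed_nat b k)%:~R / x%:C = (sign_of b * (k%:R / x))%:C :> C.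
Proof.
rewrite rmorphM fmorph_div /= rmorph_nat; case: b => /=; first by rewrite mul1r.
by rewrite mulrNz rmorphN rmorph1 mulN1r mulNr.
Qed.

Lemma mx_subZE p q (M N : 'M[C]_(p, q)) (z : C) i j : (M - z *: N) i j = M i j - z * N i j.
Proof. by rewrite !mxE. Qed.

Lemma JZJ_offdiag (Z : 'M[C]_2) i j : i != j ->
  (J *m Z *m J ^t* - Z) i j = - (Z 0 1 + Z 1 0).
Proof.
rewrite adjJ mulmxN !mxE !big_ord_recl !big_ord0 !mxE !big_ord_recl !big_ord0 !mxE.
have -> : lift 0 0 = 1 :> 'I_2 by apply/val_inj.
case: i j => [[|[|[]]] i2] // [[|[|[]]] j2] // _ /=.
  have -> : Ordinal i2 = 0 by apply/val_inj.
  have -> : Ordinal j2 = 1 by apply/val_inj.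
  by ring.
have -> : Ordinal i2 = 1 by apply/val_inj.
have -> : Ordinal j2 = 0 by apply/val_inj.
by ring.
Qed.

(** Conjugation by [J] exchanges the diagonal entries, so a large entry enters negatively at its own
    place and positively at the other. This is the source of the alternating sign. *)
Lemma JZJ_diag (Z : 'M[C]_2) b :
  (J *m Z *m J ^t* - Z) (component b) (component b) = Z (component (~~ b)) (component (~~ b)) - Z (component b) (component b).
Proof.
rewrite adjJ mulmxN !mxE !big_ord_recl !big_ord0 !mxE !big_ord_recl !big_ord0 !mxE.
have -> : lift 0 0 = 1 :> 'I_2 by apply/val_inj.
by case: b => /=; ring.
Qed.

Lemma sigma3_diag b : @sigma3 R (component b) (component b) = (sign_of b)%:C.
Proof. by rewrite mxE; case: b => //=; rewrite rmorphN. Qed.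

Lemma sigma3_offdiag i j : i != j -> @sigma3 R i j = 0.
Proof. by rewrite mxE; case: i j => [[|[|[]]] i2] // [[|[|[]]] j2]. Qed.

Lemma ReIm_mul_le (z w : C) (M : R) : `|Re w| <= M -> `|Im w| <= M ->
  `|Re (z * w)| <= M * (`|Re z| + `|Im z|) /\ `|Im (z * w)| <= M * (`|Re z| + `|Im z|).
Proof.
move=> wr wi; rewrite cxReM cxImM mulrDr; split.
  apply: (le_trans (ler_normB _ _)); rewrite !normrM; apply: lerD;
    by rewrite mulrC; apply: ler_wpM2r.
apply: (le_trans (ler_normD _ _)); rewrite !normrM; apply: lerD;
  by rewrite mulrC; apply: ler_wpM2r.
Qed.

Lemma cx_gt0E (z : C) : 0 < z -> z = (Re z)%:C /\ 0 < Re z.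
Proof. by case: z => x y; rewrite ltcE /= => /andP[/eqP -> ->]. Qed.

Lemma rank_one_entry (h : 'rV[C]_2) (tau : 'M[C]_1) i j : 0 < tau 0 0 ->
  Re ((h ^t* *m invmx tau *m h) i j) =
    (Re (h 0 i) * Re (h 0 j) + Im (h 0 i) * Im (h 0 j)) / Re (tau 0 0) /\
  Im ((h ^t* *m invmx tau *m h) i j) =
    (Re (h 0 i) * Im (h 0 j) - Im (h 0 i) * Re (h 0 j)) / Re (tau 0 0).
Proof.
move=> /cx_gt0E[tauE T0].
have -> : (h ^t* *m invmx tau *m h) i j = ((Re (tau 0 0))^-1)%:C * (Num.conj (h 0 i) * h 0 j).
  rewrite {1}[tau]mx11_scalar invmx_scalar mul_mx_scalar -scalemxAl mxE.
  by congr (_ * _); [rewrite tauE fmorphV|rewrite !mxE big_ord1 !mxE].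
rewrite cxReM cxImM (cxReM (Num.conj _)) (cxImM (Num.conj _)) !cxRe_conj !cxIm_conj /=.
by split; ring.
Qed.

Section Step.
Variables (l : R) (k : nat) (b : bool) (Qt : R -> 'M[C]_2) (a0 : 'M[C]_1).
Variables (h : R -> 'rV[C]_2) (tau : R -> 'M[C]_1).
Hypothesis l_gt0 : 0 < l.
Hypothesis Qt_bdd :
  bounded_near_zero (fun x => Qt x - ((signed_nat b k)%:~R / x%:C) *: sigma3).
Hypothesis h_ac : forall b1 b2, 0 < b1 -> b1 <= b2 -> b2 < l ->
  mx_ac b1 b2 h /\ mx_ac b1 b2 tau.
Hypothesis h_derive : {ae mu, forall x, 0 < x < l ->
  mx_is_derive h x (- (a0 *m h x *m J) + h x *m Qt x) /\
  mx_is_derive tau x (h x *m (h x) ^t*)}.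
Hypothesis tau_gt0 : forall x, 0 < x < l -> 0 < tau x 0 0.
Hypothesis tau_lim0 : tends_to0 (fun x => Re (tau x 0 0)).
Hypothesis h_start : k = 0%N -> exists2 b1, 0 < b1 &
  [/\ mx_ac 0 b1 h, h 0 0 (component b) != 0 & h 0 0 (component (~~ b)) = 0].

(** The bounded part of the coefficient, into which the term [- a0 h J] is absorbed; what remains is
    a multiple of [sigma3 / x]. *)
Let V x := Qt x - ((signed_nat b k)%:~R / x%:C) *: sigma3 - a0 0 0 *: J.
Let E x := h x *m V x.

Let h_rhs x bb : (- (a0 *m h x *m J) + h x *m Qt x) 0 (component bb) =
  (sign_of b * sign_of bb * (k%:R / x))%:C * h x 0 (component bb) + E x 0 (component bb).
Proof.
have -> : - (a0 *m h x *m J) + h x *m Qt x =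
    ((signed_nat b k)%:~R / x%:C) *: (h x *m sigma3) + E x.
  rewrite /E /V !mulmxBr -!scalemxAr {1}[a0]mx11_scalar mul_scalar_mx -scalemxAl.
  by mx_abel.
rewrite mxE [X in X + _]mxE mul_sigma3 signed_natC mulrA -rmorphM; congr (_%:C * _ + _).
by ring.
Qed.

Let h_deriv_ae bb :
  deriv_ae l (fun x => Re (h x 0 (component bb)))
    (fun x => sign_of b * sign_of bb * (k%:R / x) * Re (h x 0 (component bb)) + Re (E x 0 (component bb))) /\
  deriv_ae l (fun x => Im (h x 0 (component bb)))
    (fun x => sign_of b * sign_of bb * (k%:R / x) * Im (h x 0 (component bb)) + Im (E x 0 (component bb))).
Proof.
split; split.
- by move=> b1 b2 b10 b12 b2l; have [/(_ 0 (component bb))[]] := h_ac b10 b12 b2l.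
- apply: lebesgue_aeS h_derive => x H xl; have [hd _] := H xl.
  have [hr _] := hd 0 (component bb); rewrite h_rhs cxReD cxReM /= mul0r subr0 in hr.
  exact: hr.
- by move=> b1 b2 b10 b12 b2l; have [/(_ 0 (component bb))[]] := h_ac b10 b12 b2l.
- apply: lebesgue_aeS h_derive => x H xl; have [hd _] := H xl.
  have [_ hi] := hd 0 (component bb); rewrite h_rhs cxImD cxImM /= mul0r addr0 in hi.
  exact: hi.
Qed.

Let a1 x := Re (h x 0 (component b)).
Let b1 x := Im (h x 0 (component b)).
Let a2 x := Re (h x 0 (component (~~ b))).
Let b2 x := Im (h x 0 (component (~~ b))).
Let T x := Re (tau x 0 0).

Let tau_deriv_ae : deriv_ae l T (fun x => a1 x ^+ 2 + b1 x ^+ 2 + (a2 x ^+ 2 + b2 x ^+ 2)).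
Proof.
split.
  by move=> c1 c2 c10 c12 c2l; have [_ /(_ 0 0)[]] := h_ac c10 c12 c2l.
apply: lebesgue_aeS h_derive => x H xl; have [_ td] := H xl.
have [+ _] := td 0 0; congr is_derive.
rewrite mxE (sum_component b) !mxE cxReD !cxReM !cxRe_conj !cxIm_conj /a1 /a2 /b1 /b2.
by ring.
Qed.

Let V_bdd : bounded_near_zero V.
Proof.
apply/bounded_near_zeroP => i j; have /bounded_near_zeroP/(_ i j) Ub := Qt_bdd.
apply: eq_bdd0 (bdd0B Ub (bdd0_cst ((a0 0 0 *: J) i j))).
by apply: nearW => x; rewrite /V [RHS]mxE; congr (_ + _); rewrite [RHS]mxE.
Qed.

Let T_tends : tends_to0 T. Proof. exact: tau_lim0. Qed.

Let asymptotics : exists2 e', 0 < e' <= l & exists K, forall x, 0 < x < e' ->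
  [/\ `|(2 * k + 1)%:R * T x - x * (a1 x ^+ 2 + b1 x ^+ 2)| <= K * (x * T x),
      a2 x ^+ 2 + b2 x ^+ 2 <= K * T x &
  [/\ `|a1 x * a2 x| <= K * T x, `|a1 x * b2 x| <= K * T x,
      `|b1 x * a2 x| <= K * T x & `|b1 x * b2 x| <= K * T x]].
Proof.
have [e3 e30 [M VM]] := V_bdd.
pose e := Num.min l e3.
have e0 : 0 < e by rewrite lt_min l_gt0.
have el : e <= l by rewrite ge_min lexx.
have ee3 : e <= e3 by rewrite ge_min lexx orbT.
have in_l x : 0 < x < e -> 0 < x < l by case/andP => -> /lt_le_trans ->.
have [a1d b1d] := h_deriv_ae b; have [a2d b2d] := h_deriv_ae (~~ b).
have C1 : 1 <= 1 + `|M| :> R by rewrite lerDl.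
have sbb : sign_of b * sign_of b = 1 by rewrite /sign_of; case: (b) => /=; ring.
have sbn : sign_of b * sign_of (~~ b) = -1 by rewrite /sign_of; case: (b) => /=; ring.
have E_le x j : 0 < x < e ->
    let B := (1 + `|M|) * (`|a1 x| + `|b1 x| + `|a2 x| + `|b2 x|) in
    `|Re (E x 0 j)| <= B /\ `|Im (E x 0 j)| <= B.
  move=> xe; have xe3 : 0 < x < e3 by case/andP: xe => -> /lt_le_trans ->.
  rewrite /E mxE (sum_component b) cxReD cxImD.
  have [r1 i1] := norm_ReIm (VM _ xe3 (component b) j).
  have [r2 i2] := norm_ReIm (VM _ xe3 (component (~~ b)) j).
  have [u1 v1] := ReIm_mul_le (h x 0 (component b)) r1 i1.
  have [u2 v2] := ReIm_mul_le (h x 0 (component (~~ b))) r2 i2.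
  rewrite -/(a1 x) -/(b1 x) in u1 v1; rewrite -/(a2 x) -/(b2 x) in u2 v2.
  have S0 : 0 <= `|a1 x| + `|b1 x| + `|a2 x| + `|b2 x| by rewrite !addr_ge0.
  have MS : M * (`|a1 x| + `|b1 x| + `|a2 x| + `|b2 x|) <=
      (1 + `|M|) * (`|a1 x| + `|b1 x| + `|a2 x| + `|b2 x|).
    by apply: ler_wpM2r => //; rewrite (le_trans (ler_norm _))// lerDr.
  by split; apply: (le_trans (ler_normD _ _)); lra.
have [|||||||||e' /andP[e'0 e'e] H] := @singular_asymptotics R e (1 + `|M|) k a1 b1 a2 b2
  (fun x => Re (E x 0 (component b))) (fun x => Im (E x 0 (component b)))
  (fun x => Re (E x 0 (component (~~ b)))) (fun x => Im (E x 0 (component (~~ b)))) T e0 C1.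
- by apply: deriv_ae_eqd (deriv_ae_sub el a1d) => x _; rewrite sbb mul1r.
- by apply: deriv_ae_eqd (deriv_ae_sub el b1d) => x _; rewrite sbb mul1r.
- by apply: deriv_ae_eqd (deriv_ae_sub el a2d) => x _; rewrite sbn mulN1r mulNr.
- by apply: deriv_ae_eqd (deriv_ae_sub el b2d) => x _; rewrite sbn mulN1r mulNr.
- exact: deriv_ae_sub el tau_deriv_ae.
- by move=> x xe; have [? ?] := E_le x (component b) xe; have [? ?] := E_le x (component (~~ b)) xe.
- by move=> x /in_l /tau_gt0 /cx_gt0E[].
- exact: T_tends.
(* For [k = 0] continuity up to zero suffices: one component starts from a nonzero value and the
   other from zero. *)
- move=> /h_start[c1 c10 [hac h0 h0']].
  have [a1ac b1ac] := hac 0 (component b); have [a2ac b2ac] := hac 0 (component (~~ b)).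
  split.
  + have pq := acB (acD (acM a1ac a1ac) (acM b1ac b1ac)) (acD (acM a2ac a2ac) (acM b2ac b2ac)).
    have pos0 : 0 < Re (h 0 0 (component b)) ^+ 2 + Im (h 0 0 (component b)) ^+ 2.
      exact: sqr_ReIm_gt0.
    have [d d0 Hd] := ac_tends_to0 c10 pq pos0.
    exists d => // x /Hd; rewrite /= h0' /= !mul0r addr0 subr0 -!expr2.
    by rewrite ltr_norml => /andP[+ _]; rewrite /a1 /a2 /b1 /b2; lra.
  + by have := ac_tends_to0 c10 a2ac; rewrite /= h0' /= => H e1 /H[d d0 Hd];
      exists d => // x /Hd; rewrite subr0.
  + by have := ac_tends_to0 c10 b2ac; rewrite /= h0' /= => H e1 /H[d d0 Hd];
      exists d => // x /Hd; rewrite subr0.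
by exists e' => //; rewrite e'0 (le_trans e'e).
Qed.

(** Of the entries of [Z] only the diagonal one at [component b] is unbounded, and the asymptotics
    of [tau] say that it is [(2 k + 1) / x] up to a bounded term. *)
Lemma rank_one_step : bounded_near_zero (fun x =>
  let Z := (h x) ^t* *m invmx (tau x) *m h x in
  J *m Z *m J ^t* - Z - ((signed_nat (~~ b) (2 * k + 1))%:~R / x%:C) *: sigma3).
Proof.
have [e' /andP[e'0 e'l] [K HK]] := asymptotics.
(* Off the diagonal two entries of [Z] are added, each a combination of two quotients bounded by
   [K]. *)
apply/bounded_near_zeroP => i j; exists (K + K + K + K).
apply/near_right0P; exists e' => // x xe; have /andP[x0 xe'] := xe.
have xl : 0 < x < l by rewrite x0 (lt_le_trans xe').
have [h1 h2 [h3 h4 h5 h6]] := HK _ xe.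
have tx := tau_gt0 xl; have [tE T0] := cx_gt0E tx.
rewrite -/(T x) in T0.
have divK y : `|y| <= K * T x -> `|y / T x| <= K.
  by move=> yK; rewrite normrM normfV (gtr0_norm T0) ler_pdivrMr.
have q0 : 0 <= a2 x ^+ 2 + b2 x ^+ 2 by rewrite addr_ge0 ?sqr_ge0.
have hq : `|(a2 x ^+ 2 + b2 x ^+ 2) / T x| <= K by apply: divK; rewrite ger0_norm.
have hp : `|(2 * k + 1)%:R / x - (a1 x ^+ 2 + b1 x ^+ 2) / T x| <= K.
  have -> : (2 * k + 1)%:R / x - (a1 x ^+ 2 + b1 x ^+ 2) / T x =
      ((2 * k + 1)%:R * T x - x * (a1 x ^+ 2 + b1 x ^+ 2)) / (x * T x).
    by field; rewrite !gt_eqF.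
  rewrite normrM normfV (gtr0_norm (mulr_gt0 x0 T0)) ler_pdivrMr//.
  exact: mulr_gt0.
have K0 : 0 <= K := le_trans (normr_ge0 _) hq.
pose Z := (h x) ^t* *m invmx (tau x) *m h x.
change (let z := (J *m Z *m J ^t* - Z - ((signed_nat (~~ b) (2 * k + 1))%:~R / x%:C) *: sigma3) i j in
  `|Re z| <= K + K + K + K /\ `|Im z| <= K + K + K + K).
cbv zeta.
have [ij|ij] := eqVneq i j; last first.
  have -> : (J *m Z *m J ^t* - Z - ((signed_nat (~~ b) (2 * k + 1))%:~R / x%:C) *: sigma3) i j
      = - (Z (component b) (component (~~ b)) + Z (component (~~ b)) (component b)).
    rewrite mx_subZE JZJ_offdiag// sigma3_offdiag// mulr0 subr0.
    by case: b; rewrite //= addrC.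
  rewrite cxReN cxImN cxReD cxImD.
  have [-> ->] := rank_one_entry (h x) (component b) (component (~~ b)) tx.
  have [-> ->] := rank_one_entry (h x) (component (~~ b)) (component b) tx.
  rewrite -/(a1 x) -/(a2 x) -/(b1 x) -/(b2 x) -/(T x).
  move/divK: h3; move/divK: h4; move/divK: h5; move/divK: h6.
  rewrite !ler_norml => /andP[? ?] /andP[? ?] /andP[? ?] /andP[? ?].
  by split; apply/andP; split; lra.
have diagE bb : (J *m Z *m J ^t* - Z - ((signed_nat (~~ b) (2 * k + 1))%:~R / x%:C) *: sigma3)
    (component bb) (component bb) = Z (component (~~ bb)) (component (~~ bb)) - Z (component bb) (component bb)
      - (sign_of (~~ b) * sign_of bb * ((2 * k + 1)%:R / x))%:C.
  rewrite mx_subZE JZJ_diag sigma3_diag signed_natC -rmorphM.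
  by congr (_ - _%:C); ring.
have [Zr Zi] := rank_one_entry (h x) (component b) (component b) tx.
have [Wr Wi] := rank_one_entry (h x) (component (~~ b)) (component (~~ b)) tx.
rewrite -/Z -/(a1 x) -/(b1 x) -/(T x) in Zr Zi.
rewrite -/Z -/(a2 x) -/(b2 x) -/(T x) in Wr Wi.
have sbn : sign_of (~~ b) * sign_of b = -1 by rewrite /sign_of; case: (b) => /=; ring.
have sbb : sign_of (~~ b) * sign_of (~~ b) = 1 by rewrite /sign_of; case: (b) => /=; ring.
rewrite -ij; move: hp hq; rewrite !ler_norml => /andP[? ?] /andP[? ?].
move: i {j ij}; apply: (component_cases (b := b)); rewrite diagE ?negbK !cxReD !cxImD !cxReN !cxImN.
  rewrite sbn Zr Zi Wr Wi /=; split; apply/andP; split; lra.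
rewrite sbb Zr Zi Wr Wi /=; split; apply/andP; split; lra.
Qed.

End Step.

End RankOneStep.

(** * Induction on the number of rows *)

Section Induction.
Variables (R : realType) (l : R) (Q : R -> 'M[R[i]]_2).
Local Notation C := R[i].
Local Notation Re := (@complex.Re R).
Local Notation J := (@breveJ R).
Hypothesis l_gt0 : 0 < l.
Hypothesis QJ : forall x, J_antisymmetric (Q x).
Hypothesis Q_bdd : bounded_near_zero Q.
Variables (s : bool) (c : C).
Hypothesis c_neq0 : c != 0.

Definition start_row : 'rV[C]_2 := if s then row2 1 0 else row2 0 1.

Lemma start_row_component b : start_row 0 (component b) = (b == s)%:R.
Proof. by rewrite /start_row; case: s; rewrite mxE; case: b. Qed.

Lemma bounded_near_zeroD p q (F G : R -> 'M[C]_(p, q)) :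
  bounded_near_zero F -> bounded_near_zero G -> bounded_near_zero (fun x => F x + G x).
Proof.
move=> /bounded_near_zeroP Fb /bounded_near_zeroP Gb; apply/bounded_near_zeroP => i j.
by apply: eq_bdd0 (bdd0D (Fb i j) (Gb i j)); apply: nearW => x; rewrite mxE.
Qed.

Lemma eq_bounded_near_zero p q (F G : R -> 'M[C]_(p, q)) :
  (forall x, 0 < x < l -> F x = G x) -> bounded_near_zero F -> bounded_near_zero G.
Proof.
move=> FG /bounded_near_zeroP Fb; apply/bounded_near_zeroP => i j.
by apply: eq_bdd0 (Fb i j); apply/near_right0P; exists l => // x /FG ->.
Qed.

Lemma mx_ac_bounded p q b (F : R -> 'M[C]_(p, q)) : 0 < b -> mx_ac 0 b F ->
  bounded_near_zero F.
Proof. by move=> b0 Fac; apply/bounded_near_zeroP => i j; exact: cx_ac_bdd0 b0 (Fac i j). Qed.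

Lemma signed_natS b k : signed_nat (~~ b) k.+1 = signed_nat b k + signed_nat (~~ b) (2 * k + 1).
Proof. by rewrite -[k.+1]addn1 /signed_nat !PoszD; case: b => /=; ring. Qed.

Let l2 : 0 < l / 2 < l. Proof. by have := l_gt0 => l0; apply/andP; split; lra. Qed.

(** The size is given by an equation because [m + k.+1] and [m + k + 1] are not convertible.
    Conditions on indices, and on vectors supported in the first [m] coordinates, replace the block
    form of the initial data: they pass to leading blocks unchanged. The prescribed row is that of
    index [m], absent when [k = 0]. *)
Lemma transformed_coefficient k : forall m N (A : 'M[C]_N) Pi S, N = (m + k)%N ->
  gbdt l Q A Pi S ->
  (forall i j : 'I_N, (m <= j)%N -> (i < j)%N -> A i j = 0) ->
  (forall i j : 'I_N, (m <= i)%N || (m <= j)%N -> S 0 i j = 0) ->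
  (forall v : 'rV[C]_N, (forall i : 'I_N, (m <= i)%N -> v 0 i = 0) -> v != 0 ->
    0 < (v *m S 0 *m v ^t*) 0 0) ->
  (forall i : 'I_N, i = m :> nat -> row i (Pi 0) = c *: start_row) ->
  bounded_near_zero (fun x =>
    q0_transformed Q Pi S x - ((signed_nat (s (+) odd k) k)%:~R / x%:C) *: sigma3).
Proof.
have /andP[l20 l2l] := l2.
elim: k => [|k IH] m N A Pi S NE AB A_lower S0 S0pos Pi0.
  (* Without extra rows [S] is invertible up to zero, so [X] is absolutely continuous there and the
     singular coefficient is zero. *)
  have Su x : 0 <= x <= l / 2 -> S x \in unitmx.
    rewrite le_eqVlt => /andP[/orP[/eqP <- _|x0 xl]].
      apply: positive_unit => v; apply: S0pos => i.
      by rewrite leqNgt -[m]addn0 -NE ltn_ord.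
    by apply: (gbdt_unit AB); rewrite x0 (le_lt_trans xl).
  have Pac := gbdt_Pi_ac AB (lexx 0) (ltW l20) l2l.
  have Sac := gbdt_S_ac AB (lexx 0) (ltW l20) l2l.
  have Xac : mx_ac 0 (l / 2) (Xmx Pi S).
    apply: mx_acM => //; apply: mx_acM; first exact: mx_ac_adj.
    exact: mx_ac_inv (ltW l20) Sac Su.
  have Fac : mx_ac 0 (l / 2) (fun x => J *m Xmx Pi S x *m J ^t* - Xmx Pi S x).
    apply: mx_acB => //; apply: mx_acM; last exact: mx_ac_cst.
    by apply: mx_acM => //; exact: mx_ac_cst.
  apply: eq_bounded_near_zero (bounded_near_zeroD Q_bdd (mx_ac_bounded l20 Fac)) => x _.
  rewrite /q0_transformed addrA /signed_nat.
  by case: (s (+) odd 0); rewrite ?oppr0 mul0r scale0r subr0.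
have {}NE : N = (m + k + 1)%N by rewrite NE addn1 addnS.
subst N; pose n := (m + k)%N.
have ur0 : ursubmx (A : 'M[C]_(n + 1)) = 0.
  apply/matrixP => i j; rewrite !mxE; apply: A_lower; rewrite /= ?ord1 addn0.
    exact: leq_addr.
  exact: ltn_ord.
have AB' := lead_gbdt AB ur0.
have [b bE] : exists b, b = s (+) odd k by exists (s (+) odd k).
have IHk : bounded_near_zero (fun x => q0_transformed Q (lead_Pi Pi) (lead_S S) x
    - ((signed_nat b k)%:~R / x%:C) *: sigma3).
  rewrite bE; apply: (IH m n (ulsubmx (A : 'M[C]_(n + 1)))) => //.
  - by move=> i j mj ij; rewrite !mxE; apply: A_lower.
  - by move=> i j mij; rewrite !mxE; apply: S0.
  - move=> v v0 vn0; have := S0pos (row_mx v 0).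
    rewrite row_mx_eq0 negb_and vn0 => /(_ _ isT).
    rewrite -[S 0](@submxK _ n 1 n 1) mul_row_block adj_row mul_row_col adj0 !mul0mx !addr0 mulmx0 addr0.
    apply => i mi; rewrite mxE; case: splitP => j ij; last by rewrite mxE.
    by apply: v0; rewrite -ij.
  - move=> i im; rewrite -(Pi0 (lshift 1 i))//.
    by apply/rowP => j; rewrite !mxE.
have S0last j : last_S S 0 0 j = 0 by rewrite !mxE; apply: S0; rewrite /= addn0 leq_addr.
have step := @rank_one_step R l k b (q0_transformed Q (lead_Pi Pi) (lead_S S))
  (drsubmx (A : 'M[C]_(n + 1))) (last_h Pi S) (last_tau S) l_gt0 IHk.
have {}step : bounded_near_zero (fun x =>
    let Z := (last_h Pi S x) ^t* *m invmx (last_tau S x) *m last_h Pi S x in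
    J *m Z *m J ^t* - Z - ((signed_nat (~~ b) (2 * k + 1))%:~R / x%:C) *: sigma3).
  apply: step.
  - move=> b1 b2 b10 b12 b2l; apply: (last_ac AB) => //; first exact: ltW.
    move=> x /andP[bx xb]; apply: (gbdt_unit AB').
    by rewrite (lt_le_trans b10)// (le_lt_trans xb).
  - exact: (last_derive QJ AB ur0).
  - exact: (last_tau_gt0 AB).
  (* [tau] lies between zero and the corner entry of [S], which is continuous at zero and vanishes
     there. *)
  - have /(_ 0 0)[gac _] := corner_ac AB (ltW l20) l2l.
    have := ac_tends_to0 l20 gac.
    have -> : (Re \o (fun y => corner_S S y 0 0)) 0 = 0.
      rewrite /= /corner_S; suff -> : drsubmx (S 0 : 'M[C]_(n + 1)) 0 0 = 0 by [].
      by rewrite !mxE; apply: S0; rewrite /= addn0 leq_addr.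
    apply: (tends_to0_le l_gt0) => x xl.
    have := last_tau_le AB xl; have := last_tau_gt0 AB xl.
    rewrite lecE ltcE /= => /andP[_ t0] /andP[_ tg].
    by rewrite subr0 gtr0_norm// gtr0_norm// (lt_le_trans t0).
  - move=> k0; exists (l / 2) => //.
    have Su x : 0 <= x <= l / 2 -> lead_S S x \in unitmx.
      rewrite le_eqVlt => /andP[/orP[/eqP <- _|x0 xl]].
        apply: positive_unit => v v0; have := S0pos (row_mx v 0).
        rewrite row_mx_eq0 negb_and v0 => /(_ _ isT).
        rewrite -{1}[S 0](@submxK _ n 1 n 1) mul_row_block adj_row mul_row_col adj0 !mul0mx !addr0 mulmx0 addr0.
        apply => i mi; rewrite mxE; case: splitP => j ij; last by rewrite mxE.
        have ilt : (i < m + k)%N by rewrite ij.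
        have mki : (m + k <= i)%N by apply: leq_trans mi; rewrite k0 addn0.
        by move: ilt; rewrite ltnNge mki.
      by apply: (gbdt_unit AB'); rewrite x0 (le_lt_trans xl).
    have [hac _] := last_ac AB (lexx 0) (ltW l20) l2l Su.
    have h0 j : last_h Pi S 0 0 j = c * start_row 0 j.
      (* The off-diagonal block of [S] vanishes at zero, so the elimination subtracts nothing and
         [h(0)] is the row of index [m] itself. *)
      have -> : last_h Pi S 0 = dsubmx (Pi 0 : 'M[C]_(n + 1, 2)).
        rewrite /last_h; have -> : last_S S 0 = 0 by apply/rowP => i; rewrite S0last mxE.
        by rewrite mul0mx subr0.
      have nm : rshift n (0 : 'I_1) = m :> nat by rewrite /= addn0 /n k0 addn0.
      by have /rowP/(_ j) := Pi0 _ nm; rewrite !mxE.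
    have bs : b = s by rewrite bE k0 addbF.
    split=> //; rewrite h0 start_row_component bs ?eqxx ?mulr1//.
    by case: (s); rewrite mulr0.
apply: eq_bounded_near_zero (bounded_near_zeroD IHk step) => x xl.
have -> : s (+) odd k.+1 = ~~ b by rewrite bE /= addbN.
rewrite signed_natS rmorphD mulrDl scalerDl /q0_transformed (last_X AB xl) /=.
move: (Xmx _ _ _) (_ *m invmx _ *m _) => X Z.
by mx_expand; mx_abel.
Qed.

End Induction.

(** * Initial data and conclusion *)

(** The lower left block is chosen so that its product with [S10] is [Psi2 J Psi1^*]; the upper
    right block follows by taking adjoints, as [J^* = - J], and the lower right one is the isotropy
    of [Psi2]. *)
Lemma block_gbdt_initial (R : realType) (m k : nat)
  (A1 S10 : 'M[R[i]]_m) (A2 : 'M[R[i]]_k)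
  (Psi1 : 'M[R[i]]_(m, 2)) (Psi2 : 'M[R[i]]_(k, 2)) :
  posdef S10 ->
  A1 *m S10 - S10 *m A1 ^t* = Psi1 *m breveJ *m Psi1 ^t* ->
  Psi2 *m breveJ *m Psi2 ^t* = 0 ->
  let A := block_mx A1 0 (Psi2 *m breveJ *m Psi1 ^t* *m invmx S10) A2 in
  let S := block_mx S10 0 0 0 in
  A *m S - S *m A ^t* = col_mx Psi1 Psi2 *m breveJ *m (col_mx Psi1 Psi2) ^t*.
Proof.
move=> S1pos idS1 Psi2J; have S1u := posdef_unit S1pos.
rewrite /= adj_block adj_col !mulmx_block mul_col_mx mul_col_row.
rewrite opp_block_mx add_block_mx !adj0 !adjM adj_invmx (posdef_herm S1pos) adjJ trmxCK.
rewrite !mul0mx !mulmx0 !addr0 mulmxKV// Psi2J subr0 sub0r oppr0 -idS1.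
by rewrite mulKVmx// mulNmx mulmxN opprK mulmxA addr0.
Qed.

(** It separates the two alternatives for [h(0)], so in each case the clauses about the other one
    hold vacuously. *)
Lemma start_row_inj (R : realType) (c : R[i]) (v : 'rV[R[i]]_2) : c != 0 ->
  v = c *: row2 1 0 -> v <> c *: row2 0 1.
Proof.
move=> c0 -> /rowP/(_ 0)/eqP; rewrite !mxE /= mulr1 mulr0.
by apply/negP.
Qed.

Theorem theorem4p9 (R : realType) (l : R) (hl : 0 < l)
  (va ve vs : R -> R)
  (hva : loc_integrable l va) (hve : loc_integrable l ve)
  (hvs : loc_integrable l vs)
  (hq0 : bounded_near_zero (q0 va ve vs))
  (m k : nat) (hm : (0 < m)%N) (hk : (0 < k)%N)
  (A1 S10 : 'M[R[i]]_m) (A2 : 'M[R[i]]_k)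
  (Psi1 : 'M[R[i]]_(m, 2)) (Psi2 : 'M[R[i]]_(k, 2))
  (R21 : 'M[R[i]]_(k, m)) (A : 'M[R[i]]_(m + k))
  (hR21 : R21 = Psi2 *m breveJ *m Psi1 ^t* *m invmx S10)
  (hA : A = block_mx A1 0 R21 A2)
  (hA2 : is_trig_mx A2)
  (hA1S1 : A1 *m S10 - S10 *m A1 ^t* = Psi1 *m breveJ *m Psi1 ^t*)
  (hPsi2 : Psi2 *m breveJ *m Psi2 ^t* = 0)
  (hS10 : posdef S10)
  (Pi : R -> 'M[R[i]]_(m + k, 2)) (S : R -> 'M[R[i]]_(m + k))
  (hPi0 : Pi 0 = col_mx Psi1 Psi2)
  (hS0 : S 0 = block_mx S10 0 0 0)
  (hPi : ac_derivative `[0, l[%classic Pi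
           (fun x => A *m Pi x *m q1 + Pi x *m q0 va ve vs x))
  (hS : ac_derivative `[0, l[%classic S (fun x => Pi x *m (Pi x) ^t*))
  (hSpos : forall x, 0 < x < l -> posdef (S x))
  (c : R[i]) (hc : c != 0)
  (hh : row (Ordinal hk) Psi2 = c *: row2 1 0 \/
        row (Ordinal hk) Psi2 = c *: row2 0 1) :
  (forall (lam : R[i]) (u : R -> 'M[R[i]]_2),
     not_in_spectra A lam ->
     is_fundamental_solution l (q0 va ve vs) lam u ->
     is_fundamental_solution l (q0_transformed (q0 va ve vs) Pi S) lam
       (fun x => wA A Pi S x lam *m u x))
  /\
  exists (kappa : int) (Upsilon : R -> 'M[R[i]]_2),
    [/\ forall x, 0 < x < l ->
          q0_transformed (q0 va ve vs) Pi S x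
          = (kappa%:~R / x%:C) *: sigma3 + Upsilon x,
        bounded_near_zero Upsilon,
        (odd k /\ row (Ordinal hk) Psi2 = c *: row2 0 1) \/
          (~~ odd k /\ row (Ordinal hk) Psi2 = c *: row2 1 0) ->
        kappa = k%:Z
      & (~~ odd k /\ row (Ordinal hk) Psi2 = c *: row2 0 1) \/
          (odd k /\ row (Ordinal hk) Psi2 = c *: row2 1 0) ->
        kappa = - k%:Z].
Proof.
have QJ x : J_antisymmetric (q0 va ve vs x) by exact: q0_J_antisymmetric.
have AB : gbdt l (q0 va ve vs) A Pi S.
  by split => //; rewrite hS0 hPi0 hA hR21; exact: block_gbdt_initial.
split; first by move=> lam u; exact: darboux_fundamental.
have A_lower (i j : 'I_(m + k)) : (m <= j)%N -> (i < j)%N -> A i j = 0.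
  rewrite hA; case: (split_ordP j) => j' ->; first by rewrite /= leqNgt ltn_ord.
  case: (split_ordP i) => i' -> mj ij; first by rewrite block_mxEur mxE.
  by rewrite block_mxEdr; move/is_trig_mxP: hA2; apply; rewrite /= ltn_add2l in ij.
have S_block (i j : 'I_(m + k)) : (m <= i)%N || (m <= j)%N -> S 0 i j = 0.
  rewrite hS0; case: (split_ordP j) => j' ->; case: (split_ordP i) => i' -> /=.
  - by rewrite leqNgt ltn_ord leqNgt ltn_ord.
  - by rewrite block_mxEdl mxE.
  - by rewrite block_mxEur mxE.
  - by rewrite block_mxEdr mxE.
have S_pos (v : 'rV_(m + k)) : (forall i : 'I_(m + k), (m <= i)%N -> v 0 i = 0) ->
    v != 0 -> 0 < (v *m S 0 *m v ^t*) 0 0.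
  move=> v0; have v2 : rsubmx v = 0.
    by apply/rowP => i; rewrite !mxE; apply: v0; rewrite /= leq_addr.
  rewrite -[v]hsubmxK v2 row_mx_eq0 eqxx andbT hS0 => v1.
  rewrite mul_row_block adj_row mul_row_col !mulmx0 !addr0 mul0mx addr0.
  by have [_ +] := hS10; apply.
(* The row of index [m] of the stacked matrix is the first row of [Psi2]. *)
have Pi_row s : row (Ordinal hk) Psi2 = c *: start_row R s ->
    forall i : 'I_(m + k), i = m :> nat -> row i (Pi 0) = c *: start_row R s.
  move=> <- i im; have -> : i = rshift m (Ordinal hk) by apply/val_inj; rewrite /= addn0.
  by rewrite hPi0; apply/rowP => j; rewrite !mxE (unsplitK (inr (Ordinal hk))).
have coef s row_s := transformed_coefficient hl QJ hq0 hc erefl AB A_lower S_block S_pos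
  (Pi_row s row_s).
have decomposition s : let K := signed_nat (s (+) odd k) k in
    forall x, 0 < x < l -> q0_transformed (q0 va ve vs) Pi S x =
      (K%:~R / x%:C) *: sigma3 +
      (q0_transformed (q0 va ve vs) Pi S x - (K%:~R / x%:C) *: sigma3).
  by move=> K x _; rewrite addrC subrK.
(* The flag [s] is true for [[1 0]]; the exclusive or with the parity of [k] then yields the four
   cases of the sign. *)
case: hh => hrow.
- have hrow' := start_row_inj hc hrow.
  exists (signed_nat (true (+) odd k) k); eexists; split.
  + exact: (decomposition true).
  + exact: (coef true).
  + by move=> [[_ /hrow']//|[/negbTE -> _]].
  + by move=> [[_ /hrow']//|[-> _]].
- have hrow' H := start_row_inj hc H hrow.
  exists (signed_nat (false (+) odd k) k); eexists; split.
  + exact: (decomposition false).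
  + exact: (coef false).
  + by move=> [[-> _]|[_ /hrow']].
  + by move=> [[/negbTE -> _]|[_ /hrow']].
Qed.
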